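(* Let $(E,\mathcal{E})$ be a measurable space such that $\mathcal{E}$ is countably generated. Let $\mathcal{M}$ be the Banach space of bounded complex measures on $(E,\mathcal{E})$ with the total variation norm, and let $U_{\mathcal{M}}$ be its closed unit ball. For $Q\in\mathcal{T}(E,\mathcal{E})$, we have $Q\in\mathcal{K}^*$ if and only if $Q^*(U_{\mathcal{M}})$ is weakly sequentially compact in $\mathcal{M}$ (i.e. $Q^*$ is a weakly compact operator of $\mathcal{M}$).
   Context: A bounded positive kernel on $(E,\mathcal{E})$ is a function $Q:E\times\mathcal{E}\to\mathbb{R}_+$ such that $Q(\cdot,A)$ is $\mathcal{E}$-measurable for every $A\in\mathcal{E}$, $Q(x,\cdot)$ is a positive measure for every $x\in E$, and $\sup_{x}Q(x,E)<+\infty$; $\mathcal{T}(E,\mathcal{E})$ is the set of these. $Q^*$ is the bounded operator on $\mathcal{M}$ defined by $(Q^*\mu)(A)=\int Q(x,A)\,d\mu(x)$. A subset $M\subset\mathcal{M}$ is weakly sequentially compact if for any sequence $(\mu_n)_{n\ge1}$ in $M$ there exist $\mu\in\mathcal{M}$ and a subsequence $(\mu_{n_k})_{k\ge1}$ such that $\lim_k\langle\phi,\mu_{n_k}\rangle=\langle\phi,\mu\rangle$ for every $\phi$ in the topological dual $\mathcal{M}'$ of $\mathcal{M}$ (the limit $\mu$ need not belong to $M$). $\mathcal{K}^*=\{T_{\nu,\alpha}:\nu\in\mathcal{P},\ \alpha\in\mathcal{H}_\nu\}$, where $\mathcal{P}$ is the set of probability measures on $(E,\mathcal{E})$, $\mathcal{H}_\nu$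 is the set of nonnegative $\mathcal{E}\otimes\mathcal{E}$-measurable functions $\alpha$ on $E\times E$ such that $\lim_{m\to+\infty}\sup_{x\in E}\int_{\{y:\alpha(x,y)\ge m\}}\alpha(x,y)\,d\nu(y)=0$, and $T_{\nu,\alpha}(x,A)=\int_A\alpha(x,y)\,d\nu(y)$. *)

(* Defs.v *)
From HB Require Import structures.
From mathcomp Require Import all_boot all_order all_algebra.
From mathcomp Require Import all_classical all_reals all_analysis.
From mathcomp Require Import complex.

Set Implicit Arguments.
Unset Strict Implicit.
Unset Printing Implicit Defensive.

Import Order.TTheory GRing.Theory Num.Theory.
Import numFieldNormedType.Exports.
Import Normc.

Local Open Scope classical_set_scope.
Local Open Scope ring_scope.
Local Open Scope complex_scope.

Lemma normc_E (R : rcfType) (z : R[i]) : `|z| = (normc z)%:C.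
Proof. by []. Qed.

Lemma normc_ge0 (R : rcfType) (z : R[i]) : 0 <= normc z.
Proof. by case: z => a b /=; exact: sqrtr_ge0. Qed.

Lemma normcD (R : rcfType) (x y : R[i]) : normc (x + y) <= normc x + normc y.
Proof. by rewrite -lecR rmorphD/= -!normc_E ler_normD. Qed.

Lemma ReD (R : rcfType) (x y : R[i]) : complex.Re (x + y) = complex.Re x + complex.Re y.
Proof. by case: x; case: y. Qed.
Lemma ImD (R : rcfType) (x y : R[i]) : complex.Im (x + y) = complex.Im x + complex.Im y.
Proof. by case: x; case: y. Qed.
Lemma ReN (R : rcfType) (x : R[i]) : complex.Re (- x) = - complex.Re x.
Proof. by case: x. Qed.
Lemma ImN (R : rcfType) (x : R[i]) : complex.Im (- x) = - complex.Im x.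
Proof. by case: x. Qed.

Lemma normRe_le (R : rcfType) (z : R[i]) : `|complex.Re z| <= normc z.
Proof. by rewrite -lecR -normc_E; exact: normc_ge_Re. Qed.

Lemma normIm_le (R : rcfType) (z : R[i]) : `|complex.Im z| <= normc z.
Proof.
case: z => a b /=; rewrite -sqrtr_sqr; apply: ler_wsqrtr.
by rewrite lerDr sqr_ge0.
Qed.

Lemma normc_le (R : rcfType) (z : R[i]) :
  normc z <= `|complex.Re z| + `|complex.Im z|.
Proof.
case: z => a b /=.
have h : 0 <= `|a| + `|b| by rewrite addr_ge0.
rewrite -(ger0_norm h) -(sqrtr_sqr (`|a| + `|b|)); apply: ler_wsqrtr.
rewrite sqrrD !real_normK ?num_real// lerD2r lerDl mulrn_wge0//.
Qed.

Lemma cvg_complexP (R : realType) (u : nat -> R[i]^o) (l : R[i]^o) :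
  u @ \oo --> l <->
  ((fun n => complex.Re (u n) : R^o) @ \oo --> (complex.Re l : R^o)) /\
  ((fun n => complex.Im (u n) : R^o) @ \oo --> (complex.Im l : R^o)).
Proof.
split.
- move=> /cvgrPdist_lt ul; split; apply/cvgrPdist_lt => e e0.
  + have /ul : 0 < e%:C by rewrite ltcR.
    apply: filterS => n; rewrite normc_E ltcR; apply: le_lt_trans.
    by rewrite -ReN -ReD; exact: normRe_le.
  + have /ul : 0 < e%:C by rewrite ltcR.
    apply: filterS => n; rewrite normc_E ltcR; apply: le_lt_trans.
    by rewrite -ImN -ImD; exact: normIm_le.
- move=> [/cvgrPdist_lt ur /cvgrPdist_lt ui]; apply/cvgrPdist_lt => -[e e'].
  rewrite ltcE/= => /andP[/eqP -> e0].
  have e20 : 0 < e / 2 by rewrite divr_gt0.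
  near=> n.
  rewrite normc_E ltcR (le_lt_trans (normc_le _))// ReD ReN ImD ImN.
  rewrite [ltRHS]splitr ltrD//.
  + by near: n; exact: ur.
  + by near: n; exact: ui.
Unshelve. all: by end_near. Qed.

Section complex_measure_def.
Context d (E : measurableType d) (R : realType).
Implicit Types mu nu : set E -> R[i]^o.

(* P ranges over the finite measurable partitions of E, possibly with empty
   blocks. *)
Definition variation_sums mu : set (\bar R) :=
  [set s | exists n (P : 'I_n -> set E),
    [/\ forall i, measurable (P i), trivIset setT P, \bigcup_i P i = setT
      & s = (\sum_(i < n) normc (mu (P i)))%:E] ].

Definition total_variation mu : \bar R := ereal_sup (variation_sums mu).

Definition complex_sigma_additive mu :=
  forall F : (set E)^nat, (forall n, measurable (F n)) -> trivIset setT F ->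
  (fun n => \sum_(0 <= i < n) mu (F i)) @ \oo --> mu (\bigcup_n F n).

(* A set function is only meaningful on the measurable sets; it is normalized
   to 0 elsewhere so that Leibniz equality is equality on measurable sets. *)
Definition complex_measure_pred : {pred set E -> R[i]^o} :=
  mem [set mu | [/\ forall A, ~ measurable A -> mu A = 0,
                    complex_sigma_additive mu
                  & (total_variation mu < +oo)%E] ].

Record complex_measure := ComplexMeasure {
  complex_measure_val :> set E -> R[i]^o ;
  _ : complex_measure_val \in complex_measure_pred }.

HB.instance Definition _ := [isSub for complex_measure_val].
HB.instance Definition _ := [Choice of complex_measure by <:].

Lemma total_variation_ge0 mu : (0 <= total_variation mu)%E.
Proof.
apply: (@le_trans _ _ (normc (mu setT))%:E); first by rewrite lee_fin normc_ge0.
apply: ereal_sup_ubound; exists 1%N, (fun=> setT); split.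
- by move=> _; exact: measurableT.
- by move=> i j _ _ _; rewrite !ord1.
- by rewrite bigcup_const//; exists ord0.
- by rewrite big_ord1.
Qed.

Lemma total_variation0 : total_variation 0 = 0%E.
Proof.
apply/eqP; rewrite eq_le total_variation_ge0 andbT.
apply: ge_ereal_sup => _ [n [P [_ _ _ ->]]].
by rewrite lee_fin big1// => i _; exact: normc0.
Qed.

Lemma total_variationD mu nu :
  (total_variation (mu + nu)%R <= total_variation mu + total_variation nu)%E.
Proof.
apply: ge_ereal_sup => _ [n [P [mP tP UP ->]]].
apply: (@le_trans _ _ ((\sum_(i < n) normc (mu (P i)))%:E
                       + (\sum_(i < n) normc (nu (P i)))%:E)%E).
  rewrite -EFinD lee_fin -big_split/=; apply: ler_sum => i _; exact: normcD.
by apply: leeD; apply: ereal_sup_ubound; exists n, P.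
Qed.

Lemma total_variationZ_le (a : R[i]) mu :
  (total_variation (a *: mu)%R <= (normc a)%:E * total_variation mu)%E.
Proof.
apply: ge_ereal_sup => _ [n [P [mP tP UP ->]]].
apply: (@le_trans _ _ ((normc a)%:E * (\sum_(i < n) normc (mu (P i)))%:E)%E).
  rewrite -EFinM lee_fin mulr_sumr; apply: ler_sum => i _.
  by rewrite -normcM.
apply: lee_wpmul2l; first by rewrite lee_fin normc_ge0.
by apply: ereal_sup_ubound; exists n, P.
Qed.

Lemma normc_total_variation mu A : measurable A ->
  ((normc (mu A))%:E <= total_variation mu)%E.
Proof.
move=> mA.
apply: (@le_trans _ _ (\sum_(i < 2) normc (mu (if i == ord0 then A else ~` A)))%:E).
  rewrite lee_fin 2!big_ord_recl big_ord0 addr0/= lerDl; exact: normc_ge0.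
apply: ereal_sup_ubound.
exists 2%N, (fun i : 'I_2 => if i == ord0 then A else ~` A); split => //.
- by move=> i; case: ifP => // _; exact: measurableC.
- move=> i j _ _; case: (eqVneq i ord0) => i0; case: (eqVneq j ord0) => j0.
  + by move=> _; rewrite i0 j0.
  + by rewrite setICr => -[].
  + by rewrite setICl => -[].
  + move=> _; apply/val_inj; case: i j i0 j0 => [[|[|//]] ?] [[|[|//]] ?]//=.
- apply/seteqP; split => // x _; have [Ax|nAx] := pselect (A x).
    by exists ord0.
  by exists ord_max.
Qed.

Lemma complex_measure_submod_closed : submod_closed (complex_measure_pred).
Proof.
split.
  rewrite inE; split => //.
  - move=> F _ _; rewrite [X in X @ _](_ : _ = cst 0); first exact: cvg_cst.
    by apply/funext => n; rewrite big1.
  - by rewrite total_variation0 ltry.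
move=> a f g; rewrite !inE => -[f0 fs fv] [g0 gs gv]; split.
- move=> A mA; rewrite -[LHS]/(a *: f A + g A).
  by rewrite f0// g0// addr0 scaler0.
- move=> F mF tF.
  rewrite [X in X @ _](_ : _ = (fun n => a *: (\sum_(0 <= i < n) f (F i)) +
      \sum_(0 <= i < n) g (F i))); last first.
    by apply/funext => n; rewrite scaler_sumr -big_split.
  by apply: cvgD; [apply: cvgZr; exact: fs|exact: gs].
- apply: (le_lt_trans (total_variationD _ _)).
  rewrite lte_add_pinfty// (le_lt_trans (total_variationZ_le _ _))//.
  by rewrite lte_mul_pinfty// ?lee_fin ?normc_ge0.
Qed.

HB.instance Definition _ := GRing.isSubmodClosed.Build _ _ (complex_measure_pred)
  complex_measure_submod_closed.

HB.instance Definition _ := [SubChoice_isSubLmodule of complex_measure by <:].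

End complex_measure_def.
Arguments complex_measure_pred {d} E R.

Section complex_measure_norm.
Context d (E : measurableType d) (R : realType).
Local Notation M := (complex_measure E R).
Implicit Types mu nu : M.

Lemma total_variation_fin_num mu : total_variation mu \is a fin_num.
Proof.
rewrite ge0_fin_numE ?total_variation_ge0//.
by case: mu => f /=; rewrite inE => -[].
Qed.

(* The norm of a normedModType over R[i] takes its values in R[i]. *)
Definition tvnorm mu : R[i] := (fine (total_variation mu))%:C.

Lemma ler_tvnormD mu nu : tvnorm (mu + nu) <= tvnorm mu + tvnorm nu.
Proof.
rewrite /tvnorm -rmorphD/= lecR -fineD ?total_variation_fin_num//.
rewrite fine_le ?fin_numD ?total_variation_fin_num//.
  exact: (total_variation_fin_num (mu + nu)).
exact: total_variationD.
Qed.

Lemma tvnormZ (a : R[i]) mu : tvnorm (a *: mu) = `|a| * tvnorm mu.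
Proof.
have le b nu : fine (total_variation (b *: nu)) <= normc b * fine (total_variation nu).
  rewrite -[normc b]/(fine (normc b)%:E) -fineM ?total_variation_fin_num//.
  rewrite fine_le ?fin_numM ?total_variation_fin_num//.
  exact: (total_variationZ_le b nu).
rewrite normc_E -rmorphM/=; congr (_ %:C).
apply/eqP; rewrite eq_le le/=.
have [->|a0] := eqVneq a 0.
  by rewrite normc0 mul0r fine_ge0// total_variation_ge0.
have := le a^-1 (a *: mu); rewrite scalerA mulVf// scale1r normcV.
rewrite mulrC ler_pdivlMr 1?mulrC//.
rewrite lt_def normc_ge0 andbT; apply: contra_neq a0; exact: eq0_normc.
Qed.

Lemma tvnorm_eq0 mu : tvnorm mu = 0 -> mu = 0.
Proof.
move=> /(congr1 (@complex.Re R))/= mu0; apply/val_inj/funext => A /=.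
have [mA|nmA] := pselect (measurable A); last first.
  by case: mu {mu0} => f /=; rewrite inE => -[->].
apply: eq0_normc; apply/eqP; rewrite eq_le normc_ge0 andbT.
by rewrite -lee_fin -mu0 fineK ?total_variation_fin_num// normc_total_variation.
Qed.

HB.instance Definition _ :=
  Lmodule_isNormed.Build R[i] M ler_tvnormD tvnormZ tvnorm_eq0.

End complex_measure_norm.


Section complex_measure_of_finite.
Context d (E : measurableType d) (R : realType).

Lemma fine_measure_sum (m : {finite_measure set E -> \bar R}) (F : (set E)^nat) :
  (forall n, measurable (F n)) -> trivIset setT F ->
  (fun n => \sum_(0 <= i < n) fine (m (F i)) : R^o) @ \oo -->
    (fine (m (\bigcup_n F n)) : R^o).
Proof.
move=> mF tF.
have mU : measurable (\bigcup_n F n) by exact: bigcup_measurable.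
have := @measure_semi_sigma_additive _ _ _ m F mF tF mU.
rewrite -[X in _ --> X](fineK (fin_num_measure m _ mU)) => /fine_cvg.
apply: cvg_trans; apply: near_eq_cvg; apply: nearW => n /=.
by rewrite sum_fine// => i _; rewrite fin_num_measure.
Qed.

Lemma fine_measure_part (m : {finite_measure set E -> \bar R}) n (P : 'I_n -> set E) :
  (forall i, measurable (P i)) -> trivIset setT P ->
  \sum_(i < n) fine (m (P i)) <= fine (m setT).
Proof.
move=> mP tP; rewrite sum_fine; last by move=> i _; rewrite fin_num_measure.
have mU : measurable (\big[setU/set0]_(i < n) P i) by exact: bigsetU_measurable.
rewrite -measure_bigsetU_ord// fine_le ?fin_num_measure//.
by rewrite le_measure ?inE.
Qed.

Lemma complex_measure_of_finite (m1 m2 m3 m4 : {finite_measure set E -> \bar R})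
    (mu : set E -> R[i]^o) :
  (forall A, ~ measurable A -> mu A = 0) ->
  (forall A, measurable A -> mu A =
     (fine (m1 A) - fine (m2 A)) +i* (fine (m3 A) - fine (m4 A))) ->
  mu \in complex_measure_pred E R.
Proof.
move=> mu0 muE; rewrite inE; split => //.
- move=> F mF tF; apply/cvg_complexP.
  rewrite muE; last exact: bigcup_measurable.
  rewrite /=; split.
  + rewrite [X in X @ _](_ : _ = (fun n => \sum_(0 <= i < n) fine (m1 (F i)) -
       \sum_(0 <= i < n) fine (m2 (F i)))); last first.
      apply/funext => n; rewrite -sumrB (big_morph _ (@ReD R) (erefl _)).
      by apply: eq_bigr => i _; rewrite muE.
    by apply: cvgB; exact: fine_measure_sum.
  + rewrite [X in X @ _](_ : _ = (fun n => \sum_(0 <= i < n) fine (m3 (F i)) -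
       \sum_(0 <= i < n) fine (m4 (F i)))); last first.
      apply/funext => n; rewrite -sumrB (big_morph _ (@ImD R) (erefl _)).
      by apply: eq_bigr => i _; rewrite muE.
    by apply: cvgB; exact: fine_measure_sum.
- apply: (@le_lt_trans _ _ (fine (m1 setT) + fine (m2 setT) +
    (fine (m3 setT) + fine (m4 setT)))%:E); last exact: ltry.
  apply: ge_ereal_sup => _ [n [P [mP tP _ ->]]]; rewrite lee_fin.
  apply: (@le_trans _ _ (\sum_(i < n) (fine (m1 (P i)) + fine (m2 (P i)) +
    (fine (m3 (P i)) + fine (m4 (P i)))))).
    apply: ler_sum => i _; apply: (le_trans (normc_le _)); rewrite muE//=.
    have m0 (m : {finite_measure set E -> \bar R}) : `|fine (m (P i))| = fine (m (P i)).
      by rewrite ger0_norm// fine_ge0.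
    by rewrite lerD// (le_trans (ler_normB _ _))// !m0.
  by rewrite !big_split/= !lerD//; exact: fine_measure_part.
Qed.

End complex_measure_of_finite.

Section complex_integral.
Context d (E : measurableType d) (R : realType).
Implicit Type mu : complex_measure E R.

Lemma complex_measureP mu :
  [/\ forall A, ~ measurable A -> mu A = 0, complex_sigma_additive mu
    & (total_variation mu < +oo)%E].
Proof. by case: mu => f /=; rewrite inE. Qed.

Lemma complex_measure0 mu : mu set0 = 0.
Proof.
have [_ + _] := complex_measureP mu.
have t0 : trivIset setT (fun _ : nat => set0 : set E) by move=> i j _ _ [x []].
move=> /(_ (fun=> set0) (fun=> measurable0) t0); rewrite bigcup0// => h.
have /cvg_series_cvg_0 : cvgn (series (fun=> mu set0 : R[i]^o)).
  by apply/cvg_ex; exists (mu set0).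
by move=> h0; apply: (cvg_unique _ (cvg_cst _) h0); exact: norm_hausdorff.
Qed.

Definition re_part mu (A : set E) : \bar R := (complex.Re (mu A))%:E.
Definition im_part mu (A : set E) : \bar R := (complex.Im (mu A))%:E.

Lemma re_part_semi_sigma_additive mu : semi_sigma_additive (re_part mu).
Proof.
move=> F mF tF _; have [_ /(_ F mF tF) /cvg_complexP[+ _] _] := complex_measureP mu.
rewrite /re_part => h; apply: cvg_EFin; first by apply: nearW => n; rewrite sumEFin.
move: h; apply: cvg_trans; apply: near_eq_cvg; apply: nearW => n /=.
by rewrite sumEFin/= (big_morph _ (@ReD R) (erefl _)).
Qed.

Lemma im_part_semi_sigma_additive mu : semi_sigma_additive (im_part mu).
Proof.
move=> F mF tF _; have [_ /(_ F mF tF) /cvg_complexP[_ +] _] := complex_measureP mu.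
rewrite /im_part => h; apply: cvg_EFin; first by apply: nearW => n; rewrite sumEFin.
move: h; apply: cvg_trans; apply: near_eq_cvg; apply: nearW => n /=.
by rewrite sumEFin/= (big_morph _ (@ImD R) (erefl _)).
Qed.

Lemma re_part0 mu : re_part mu set0 = 0%E.
Proof. by rewrite /re_part complex_measure0. Qed.
Lemma im_part0 mu : im_part mu set0 = 0%E.
Proof. by rewrite /im_part complex_measure0. Qed.

HB.instance Definition _ mu := isCharge.Build _ _ _ (re_part mu) (re_part0 mu)
  (fun _ _ => isT) (@re_part_semi_sigma_additive mu).
HB.instance Definition _ mu := isCharge.Build _ _ _ (im_part mu) (im_part0 mu)
  (fun _ _ => isT) (@im_part_semi_sigma_additive mu).

End complex_integral.

Section jordan_integral.
Context d (E : measurableType d) (R : realType).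
Implicit Type nu : {charge set E -> \bar R}.

Let hahn nu : {PN : set E * set E | hahn_decomposition nu PN.1 PN.2}.
Proof. by apply: cid; have [P [N ?]] := Hahn_decomposition nu; exists (P, N). Qed.

Definition hahn_pos nu : set E := (sval (hahn nu)).1.
Definition hahn_neg nu : set E := (sval (hahn nu)).2.
Lemma hahnP nu : hahn_decomposition nu (hahn_pos nu) (hahn_neg nu).
Proof. exact: svalP (hahn nu). Qed.

(* Integration against a signed measure through its Jordan decomposition, which
   does not depend on the chosen Hahn decomposition. *)
Definition charge_integral nu (f : E -> R) : R :=
  \int[jordan_pos (hahnP nu)]_x f x - \int[jordan_neg (hahnP nu)]_x f x.

Definition complex_integral (mu : complex_measure E R) (f : E -> R) : R[i] :=
  charge_integral (re_part mu) f +i* charge_integral (im_part mu) f.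

End jordan_integral.

Section kernel_adjoint.
Context d (E : measurableType d) (R : realType) (Q : R.-fker E ~> E).

Section kernel_integral.
Variable m : {finite_measure set E -> \bar R}.

Let kint (A : set E) : \bar R := (\int[m]_x Q x A)%E.

Let kint0 : kint set0 = 0%E.
Proof. by rewrite /kint integral0_eq. Qed.

Let kint_ge0 A : (0 <= kint A)%E.
Proof. exact: integral_ge0. Qed.

Let kint_sigma : semi_sigma_additive kint.
Proof.
move=> F mF tF mU; rewrite /kint.
have -> : (\int[m]_x Q x (\bigcup_n F n))%E = (\sum_(n <oo) \int[m]_x Q x (F n))%E.
  rewrite -integral_nneseries//; last first.
    by move=> n; exact: measurable_kernel.
  by apply: eq_integral => x _; rewrite measure_semi_bigcup.
by apply: is_cvg_nneseries => n _ _; exact: integral_ge0.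
Qed.

HB.instance Definition _ := isMeasure.Build _ _ _ kint kint0 kint_ge0 kint_sigma.

Let kint_fin : fin_num_fun kint.
Proof.
move=> A mA; rewrite ge0_fin_numE//.
have [r Qr] := measure_uub Q.
have r0 : (0 <= r%:E)%E by apply: ltW; exact: le_lt_trans (measure_ge0 (Q point) setT) (Qr point).
apply: (@le_lt_trans _ _ (\int[m]_x (cst r%:E x))%E).
  apply: ge0_le_integral => //.
  - exact: measurable_kernel.
  - move=> x _; apply: ltW; apply: le_lt_trans (Qr x).
    by apply: le_measure; rewrite ?inE.
rewrite integral_cst// lte_mul_pinfty//.
by rewrite ltey_eq fin_num_measure.
Qed.

HB.instance Definition _ := Measure_isFinite.Build _ _ _ kint kint_fin.

Definition kernel_integral : {finite_measure set E -> \bar R} := kint.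

Lemma kernel_integralE A : measurable A ->
  \int[m]_x fine (Q x A) = fine (kernel_integral A).
Proof.
move=> mA; congr fine; apply: eq_integral => x _; rewrite fineK//.
exact: kernel_finite_transition.
Qed.

End kernel_integral.

(* Q x A is finite, so fine is only a change of type. *)
Definition kernel_adjoint_fun (mu : complex_measure E R) (A : set E) : R[i]^o :=
  if A \in measurable then complex_integral mu (fun x => fine (Q x A)) else 0.

Lemma kernel_adjoint_subproof mu : kernel_adjoint_fun mu \in complex_measure_pred E R.
Proof.
apply: (@complex_measure_of_finite _ _ _
  (kernel_integral (jordan_pos (hahnP (re_part mu))))
  (kernel_integral (jordan_neg (hahnP (re_part mu))))
  (kernel_integral (jordan_pos (hahnP (im_part mu))))
  (kernel_integral (jordan_neg (hahnP (im_part mu))))) => A mA.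
- by rewrite /kernel_adjoint_fun memNset.
- by rewrite /kernel_adjoint_fun mem_set// /complex_integral /charge_integral !kernel_integralE.
Qed.

Definition kernel_adjoint (mu : complex_measure E R) : complex_measure E R :=
  ComplexMeasure (kernel_adjoint_subproof mu).

End kernel_adjoint.

(* Relative notion: the limit l is not required to lie in M. *)
Definition weakly_sequentially_compact (K : numFieldType) (V : normedModType K)
    (M : set V) :=
  forall u : nat -> V, (forall n, M (u n)) ->
  exists (l : V) (s : nat -> nat), increasing_seq s /\
    forall phi : {linear V -> K^o}, continuous phi ->
      phi (u (s k)) @[k --> \oo] --> phi l.

Definition countably_generated d (E : measurableType d) :=
  exists2 G : set (set E), countable G & @measurable d E = <<s G >>.

Section Kstar.
Context d (E : measurableType d) (R : realType).

Definition uniformly_integrable_densities (nu : probability E R) : set (E * E -> R) :=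
  [set alpha : E * E -> R | [/\ forall z, 0 <= alpha z, measurable_fun [set: E * E] alpha &
    ereal_sup (range (fun x =>
      (\int[nu]_(y in [set y | (m <= alpha (x, y))%R]) (alpha (x, y))%:E)%E))
      @[m --> +oo%R] --> 0%E ] ].

Definition density_kernel (nu : probability E R) (alpha : E * E -> R)
    (x : E) (A : set E) : \bar R :=
  (\int[nu]_(y in A) (alpha (x, y))%:E)%E.

(* Kernels are compared on measurable sets only: the values of a measure on
   non-measurable sets are irrelevant. *)
Definition Kstar : set (R.-fker E ~> E) :=
  [set Q : R.-fker E ~> E | exists (nu : probability E R) (alpha : E * E -> R),
    uniformly_integrable_densities nu alpha /\
    forall x A, measurable A -> Q x A = density_kernel nu alpha x A].

End Kstar.
Arguments Kstar {d E R} Q.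

(* Main.v *)
(* Weak compactness of Q^* on the unit ball is weak compactness of the set of
   measures Q(x, .), since Dirac measures lie in the ball and
   |Q^* mu (A)| <= C |mu| sup_x Q(x, A).

   Compactness => K^*.  A weak limit is a countably additive measure, so sets A_n
   with Q(x_n, A_n) >= e cannot have an upper limit that is null for every
   Q(x_n, .).  This yields countably many points z_k such that
   nu = sum_k 2^-k Q(z_k, .), normalized, controls all Q(x, .) uniformly.  As the
   sigma-algebra is countably generated, L^1(nu) has a countable dense family of
   simple functions, and approximating dQ(x, .)/dnu by members of this family
   chosen measurably in x gives a jointly measurable density.

   K^* => compactness.  Uniform integrability makes the measures Q^* mu_n
   uniformly absolutely continuous with respect to nu, so a diagonal subsequence
   that converges on a countable nu-dense family of sets converges on every
   measurable set.  A continuous functional restricted to densities with respect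
   to nu is integration against a bounded function, hence is approximated by
   finite combinations of evaluations at sets. *)
From HB Require Import structures.
Require Import Defs.
From mathcomp Require Import all_boot all_order all_algebra.
From mathcomp Require Import all_classical all_reals all_analysis.
From mathcomp Require Import measurable_realfun ring lra complex.

Set Implicit Arguments.
Unset Strict Implicit.
Unset Printing Implicit Defensive.

Import Order.TTheory GRing.Theory Num.Theory.
Import numFieldNormedType.Exports.
Import Normc.

Local Open Scope classical_set_scope.
Local Open Scope ring_scope.
Local Open Scope complex_scope.

Lemma increasing_seq_ge (s : nat -> nat) n : increasing_seq s -> (n <= s n)%N.
Proof.
move=> sinc; elim: n => // n ih; apply: (leq_ltn_trans ih).
by move/increasing_seqP : sinc => /(_ n); rewrite ltEnat.
Qed.

(** * Complex measures and the adjoint kernel *)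

Section measures_to_complex.
Context d (E : measurableType d) (R : realType).
Local Notation M := (complex_measure E R).

(** The value 0 off the measurable sets is the normalization required by [complex_measure_pred]. *)
Definition complex_of_charges_fun (c1 c2 : {charge set E -> \bar R})
    (A : set E) : R[i]^o :=
  if A \in measurable then fine (c1 A) +i* fine (c2 A) else 0.

Lemma fine_jordan (c : {charge set E -> \bar R}) A : measurable A ->
  fine (c A) = fine (jordan_pos (hahnP c) A) - fine (jordan_neg (hahnP c) A).
Proof.
move=> mA; rewrite {1}(jordan_decomp (hahnP c) mA) /cadd/= cscaleN1.
by rewrite fineB// fin_num_measure.
Qed.

Lemma complex_of_charges_subproof (c1 c2 : {charge set E -> \bar R}) :
  complex_of_charges_fun c1 c2 \in complex_measure_pred E R.
Proof.
apply: (@complex_measure_of_finite _ _ _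
  (jordan_pos (hahnP c1)) (jordan_neg (hahnP c1))
  (jordan_pos (hahnP c2)) (jordan_neg (hahnP c2))) => A mA.
- by rewrite /complex_of_charges_fun memNset.
- by rewrite /complex_of_charges_fun mem_set// -!fine_jordan.
Qed.

Definition complex_of_charges c1 c2 : M :=
  ComplexMeasure (complex_of_charges_subproof c1 c2).

Lemma complex_of_chargesE c1 c2 A : measurable A ->
  complex_of_charges c1 c2 A = fine (c1 A) +i* fine (c2 A).
Proof. by move=> mA; rewrite /= /complex_of_charges_fun mem_set. Qed.

Lemma complex_measureNmeas (mu : M) A : ~ measurable A -> mu A = 0.
Proof. by have [+ _ _] := complex_measureP mu; exact. Qed.

Lemma complex_measure_eq (mu nu : M) :
  (forall A, measurable A -> mu A = nu A) -> mu = nu.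
Proof.
move=> munu; apply/val_inj/funext => A /=.
have [mA|nmA] := pselect (measurable A); first exact: munu.
by rewrite !complex_measureNmeas.
Qed.

Definition complex_of_measure (m : {finite_measure set E -> \bar R}) : M :=
  complex_of_charges (charge_of_finite_measure m) (@czero _ E R).

Lemma complex_of_measureE (m : {finite_measure set E -> \bar R}) A :
  measurable A -> complex_of_measure m A = (fine (m A))%:C.
Proof. by move=> mA; rewrite complex_of_chargesE. Qed.

Lemma norm_complex_of_measure (m : {finite_measure set E -> \bar R}) :
  `|complex_of_measure m| <= (fine (m setT))%:C.
Proof.
rewrite lecR -lee_fin fineK ?total_variation_fin_num//.
apply: ge_ereal_sup => _ [n [P [mP tP _ ->]]]; rewrite lee_fin.
apply: le_trans _ (fine_measure_part m mP tP).
apply: ler_sum => i _; rewrite complex_of_measureE//.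
by rewrite /= expr0n/= addr0 sqrtr_sqr ger0_norm// fine_ge0.
Qed.

(** The Hahn decomposition is an arbitrary choice, so its negative set may be nonempty. It is still
    null, since a nonnegative measure vanishes on every measurable part of a negative set. *)
Lemma charge_integral_measure (c : {charge set E -> \bar R})
    (m : {finite_measure set E -> \bar R}) (f : E -> R) :
  (forall A, measurable A -> c A = m A) ->
  charge_integral c f = \int[m]_x f x.
Proof.
move=> cm; rewrite /charge_integral.
have [[mP _] [mN negN] _ _] := hahnP c.
have neg0 A : measurable A -> jordan_neg (hahnP c) A = 0%E.
  move=> mA; rewrite jordan_negE cjordan_negE /crestr0 mem_set// /crestr.
  have mAN : measurable (A `&` hahn_neg c) by exact: measurableI.
  apply/eqP; rewrite eqe_oppLR oppe0 eq_le negN//=.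
  by rewrite cm.
have -> : \int[jordan_neg (hahnP c)]_x f x = 0.
  rewrite /Rintegral (eq_measure_integral (@mzero _ E R)).
    by rewrite integral_measure_zero.
  by move=> A mA _; exact: neg0.
rewrite subr0 /Rintegral; congr fine; apply: eq_measure_integral => A mA _.
have := @jordan_decomp _ _ _ _ _ _ (hahnP c) A mA.
by rewrite cm// /cadd/= cscaleN1 [X in (_ - X)%E]neg0// oppe0 adde0 => <-.
Qed.

Lemma charge_integral0 (c : {charge set E -> \bar R}) (f : E -> R) :
  (forall A, measurable A -> c A = 0%E) -> charge_integral c f = 0.
Proof.
move=> c0.
have fz : fin_num_fun (@mzero _ E R) by [].
pose z : {finite_measure set E -> \bar R} := HB.pack_for
  {finite_measure set E -> \bar R} (@mzero _ E R)
  (@Measure_isFinite.Build _ _ _ (@mzero _ E R) fz).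
rewrite (@charge_integral_measure c z)// /Rintegral.
by rewrite (eq_measure_integral (@mzero _ E R))// integral_measure_zero.
Qed.

Lemma complex_integral_measure (m : {finite_measure set E -> \bar R})
    (f : E -> R) :
  complex_integral (complex_of_measure m) f = (\int[m]_x f x)%:C.
Proof.
rewrite /complex_integral (@charge_integral_measure _ m); last first.
  by move=> A mA; rewrite /= /re_part complex_of_measureE//= fineK ?fin_num_measure.
by rewrite charge_integral0// => A mA; rewrite /= /im_part complex_of_measureE.
Qed.

Lemma kernel_adjoint_measure (Q : R.-fker E ~> E)
    (m : {finite_measure set E -> \bar R}) (A : set E) : measurable A ->
  kernel_adjoint Q (complex_of_measure m) A = (\int[m]_x fine (Q x A))%:C.
Proof.
by move=> mA; rewrite /= /kernel_adjoint_fun mem_set// complex_integral_measure.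
Qed.

(** Dirac measures lie in the unit ball, so every [Q x] lies in the image whose compactness is
    studied. *)
Lemma kernel_adjoint_dirac (Q : R.-fker E ~> E) (x : E) (A : set E) :
  measurable A ->
  kernel_adjoint Q (complex_of_measure (@dirac _ E x R)) A = (fine (Q x A))%:C.
Proof.
move=> mA; rewrite kernel_adjoint_measure// /Rintegral integral_dirac//.
  by rewrite diracT mul1e.
apply/measurable_EFinP; apply: measurableT_comp => //.
exact: measurable_kernel.
Qed.

(** Named so that it can carry a linear structure: these are the test functionals that turn weak
    convergence into setwise convergence. *)
Definition eval_measure (A : set E) (mu : M) : R[i]^o := mu A.

Lemma eval_measure_linear A : linear (eval_measure A).
Proof. by []. Qed.

HB.instance Definition _ A :=
  GRing.isLinear.Build R[i] M R[i]^o *:%R (eval_measure A) (eval_measure_linear A).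

Lemma norm_eval_measure (mu : M) A : `|mu A| <= `|mu|.
Proof.
have [mA|nmA] := pselect (measurable A); last first.
  by rewrite complex_measureNmeas// normr0.
rewrite normc_E lecR -lee_fin fineK ?total_variation_fin_num//.
exact: normc_total_variation.
Qed.

Lemma eval_measure_continuous A : continuous (eval_measure A).
Proof.
apply/linear_bounded_continuous/linear_boundedP.
near=> r => mu.
rewrite (le_trans (norm_eval_measure mu A))// ler_peMl//.
Unshelve. all: by end_near.
Qed.

End measures_to_complex.

(** * Weak compactness and upper limits of sets *)

Section weakly_compact_kernel.
Context d (E : measurableType d) (R : realType) (Q : R.-fker E ~> E).

(** The tails decrease to the upper limit; continuity from above is applied to the two Jordan
    parts. *)
Lemma cvg_charge_limsup (c : {charge set E -> \bar R}) (A : (set E)^nat) :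
  (forall n, measurable (A n)) ->
  fine (c (\bigcup_(j >= n) A j)) @[n --> \oo] --> fine (c (lim_sup_set A)).
Proof.
move=> mA.
have mU n : measurable (\bigcup_(j >= n) A j) by exact: bigcup_measurable.
have mL : measurable (lim_sup_set A) by exact: bigcap_measurable.
have cvg_m (m : {finite_measure set E -> \bar R}) :
    fine (m (\bigcup_(j >= n) A j)) @[n --> \oo] --> fine (m (lim_sup_set A)).
  apply: fine_cvg; rewrite fineK ?fin_num_measure//.
  by apply: lim_sup_set_cvg => //; rewrite ltey_eq fin_num_measure.
under eq_fun do rewrite fine_jordan//.
by rewrite fine_jordan//; apply: cvgB; exact: cvg_m.
Qed.

(* A uniform countable additivity of the measures Q x, phrased with upper
   limits of sets: it excludes that every Q (x n) vanishes on the upper limit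
   of sets A n that carry mass e of Q (x n). *)
Definition limsup_charging :=
  forall (A : (set E)^nat) (x : nat -> E) (e : R),
    (forall n, measurable (A n)) -> 0 < e ->
    (forall n, (e%:E <= Q (x n) (A n))%E) ->
    exists n, (Q (x n) (lim_sup_set A) != 0)%E.

(** If every [Q (x n)] vanished on the upper limit, so would the weak limit [l] of a subsequence.
    Some tail of the sets would then have [l]-mass below [e], hence eventually [Q (x (s k))]-mass
    below [e], although it contains [A (s k)]. *)
Lemma weakly_compact_kernel_limsup :
  weakly_sequentially_compact
    (kernel_adjoint Q @` [set mu : complex_measure E R | `|mu| <= 1]) ->
  limsup_charging.
Proof.
move=> wc A x e mA e0 eA; apply: contrapT => /forallNP Q0.
have mU n : measurable (\bigcup_(j >= n) A j) by exact: bigcup_measurable.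
have mL : measurable (lim_sup_set A) by exact: bigcap_measurable.
have [n|l [s [sinc sl]]] := wc (fun n =>
    kernel_adjoint Q (complex_of_measure (@dirac _ E (x n) R))).
  exists (complex_of_measure (@dirac _ E (x n) R)) => //=.
  by apply: (le_trans (norm_complex_of_measure _)); rewrite /= indicT.
have cvgB B : measurable B ->
    fine (Q (x (s k)) B) @[k --> \oo] --> fine (re_part l B).
  move=> mB; have := sl (eval_measure B) (@eval_measure_continuous _ _ _ B).
  move=> /cvg_complexP[+ _]; apply: cvg_trans; apply: near_eq_cvg.
  apply: nearW => k.
  exact: (congr1 (@complex.Re R) (kernel_adjoint_dirac Q (x (s k)) mB)).
have lL0 : fine (re_part l (lim_sup_set A)) = 0.
  have := cvgB _ mL; rewrite (_ : (fun k => _) = cst 0); last first.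
    apply/funext => k; rewrite (_ : Q (x (s k)) _ = 0%E)//.
    by apply/eqP; apply: contrapT => /negP; exact: Q0.
  by move=> /cvg_unique; apply => //; exact: cvg_cst.
have := @cvg_charge_limsup (re_part l) A mA; rewrite lL0 => /cvgr_lt/(_ e e0).
move=> [N _ /(_ N (leqnn N))/= lN].
have /cvgr_lt/(_ e lN) [K _ KN] := cvgB _ (mU N).
(* Being at least [K] makes the tail from [N] light for [Q (x (s k))]; being at least [N], with
   [k <= s k], puts [A (s k)] inside that tail. *)
pose k := maxn K N.
have := KN k (leq_maxl _ _); apply/negP; rewrite -leNgt.
rewrite -lee_fin fineK; last exact: kernel_finite_transition.
rewrite (le_trans (eA (s k)))// le_measure ?inE//.
apply: bigcup_sup => /=.
exact: leq_trans (leq_maxr K N) (increasing_seq_ge k sinc).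
Qed.

End weakly_compact_kernel.

(** * Control measure *)

Section control_measure.
Context d (E : measurableType d) (R : realType).

Lemma nneseries_half_le (u : (\bar R)^nat) (C : R) : 0 <= C ->
  (forall n, (0 <= u n)%E) -> (forall n, (u n <= (C / 2 ^+ n.+1)%:E)%E) ->
  (\sum_(n <oo) u n <= C%:E)%E.
Proof.
move=> C0 u0 uC; apply: lime_le; first exact: is_cvg_nneseries.
(* The exact geometric partial sum, a bound strong enough to be carried through the induction. *)
apply: nearW => k; apply: (@le_trans _ _ (C - C / 2 ^+ k)%:E); last first.
  by rewrite lee_fin lerBlDr lerDl divr_ge0// exprn_ge0.
elim: k => [|k ih]; first by rewrite big_nil expr0 divr1 subrr.
rewrite big_nat_recr//=; apply: (le_trans (leeD ih (uC k))).
rewrite -EFinD lee_fin exprS le_eqVlt; apply/orP; left; apply/eqP.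
have : (2 : R) ^+ k != 0 by rewrite expf_eq0/= pnatr_eq0 andbF.
move: (2 ^+ k) => t t0; field.
exact: t0.
Qed.

(** Borel-Cantelli for a geometric majorant. *)
Lemma limsup_null (m : {measure set E -> \bar R}) (A : (set E)^nat) (C : R) :
  (forall n, measurable (A n)) -> 0 <= C ->
  (forall n, (m (A n) <= (C / 2 ^+ n.+1)%:E)%E) -> m (lim_sup_set A) = 0%E.
Proof.
move=> mA C0 mAC; apply: lim_sup_set_cvg0 => //.
by rewrite (le_lt_trans (nneseries_half_le C0 _ mAC))// ltry.
Qed.

Variable Q : R.-fker E ~> E.
Hypothesis Qls : limsup_charging Q.

Lemma kernel_bounded : {r : R | 0 < r & forall x A, measurable A ->
  (Q x A <= r%:E)%E}.
Proof.
apply: cid2; have [r Qr] := measure_uub Q; exists r.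
  by rewrite -lte_fin; apply: le_lt_trans (Qr point).
move=> x A mA; apply/ltW/(le_lt_trans _ (Qr x)).
by rewrite le_measure ?inE.
Qed.

(** Otherwise one chooses recursively [A n] and [y n] with [Q (y n) (A n) >= e] while [A n] has mass
    below [2 ^- n.+1] for all earlier points. By Borel-Cantelli each [Q (y n)] then vanishes on the
    upper limit of the sets, against [limsup_charging]. *)
Lemma finite_uniform_control (e : R) : 0 < e ->
  exists s : seq E, exists2 t : R, 0 < t & forall A, measurable A ->
    (forall i, (i < size s)%N -> (Q (nth point s i) A < t%:E)%E) ->
    forall y, (Q y A < e%:E)%E.
Proof.
move=> e0; apply: contrapT => /forallNP H.
have {H} : forall s : seq E, exists Ay : set E * E, [/\ measurable Ay.1,
    (forall i, (i < size s)%N ->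
       (Q (nth point s i) Ay.1 < (2 ^- (size s).+1)%:E)%E) &
    (e%:E <= Q Ay.2 Ay.1)%E].
  move=> s; have := H s => /forall2NP/(_ (2 ^- (size s).+1)) [|].
    by rewrite invr_gt0 exprn_gt0.
  move=> /existsNP[A] /not_implyP[mA] /not_implyP[sA] /existsNP[y] /negP.
  by rewrite -leNgt => yA; exists (A, y).
move=> /choice[f fP].
(* [s n] lists the first [n] chosen points; [f] selects the next set and point against this list. *)
pose s := fix s n := if n is m.+1 then rcons (s m) (f (s m)).2 else [::].
have size_s n : size (s n) = n by elim: n => //= n ih; rewrite size_rcons ih.
pose A n := (f (s n)).1; pose y n := (f (s n)).2.
have nth_s n i : (i < n)%N -> nth point (s n) i = y i.
  elim: n => // n ih; rewrite ltnS leq_eqVlt /= nth_rcons size_s.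
  case/predU1P => [->|lin]; first by rewrite ltnn eqxx.
  by rewrite lin ih.
have mA n : measurable (A n) by have [] := fP (s n).
have [] := Qls mA e0 (x := y).
  by move=> n; have [] := fP (s n).
move=> n; apply/negP; rewrite negbK; apply/eqP.
have [r r0 Qr] := kernel_bounded.
(* Only the sets with index [k > n] are known to be light for [y n]. The factor [2 ^+ n.+1] makes
   the majorant at least [r] for the indices [k <= n], and the [+ 1] makes the constant at least 1
   for the others. *)
apply: (@limsup_null _ _ ((r + 1) * 2 ^+ n.+1)) => //.
  by rewrite mulr_ge0// ?exprn_ge0// addr_ge0// ltW.
move=> k; have [kn|nk] := leqP k n.
  apply: (le_trans (Qr _ _ (mA k))); rewrite lee_fin -mulrA.
  have le1 : 1 <= (2 : R) ^+ n.+1 / 2 ^+ k.+1.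
    by rewrite ler_pdivlMr ?exprn_gt0// mul1r ler_weXn2l// ler1n.
  apply: (@le_trans _ _ (r + 1)); first by rewrite lerDl.
  by rewrite ler_peMr// addr_ge0// ltW.
have [_ /(_ n) + _] := fP (s k); rewrite size_s => /(_ nk).
rewrite nth_s// => /ltW/le_trans; apply; rewrite lee_fin.
rewrite ler_peMl ?invr_ge0 ?exprn_ge0//.
rewrite -[leLHS]mul1r ler_pM// ?lerDr ?ltW//.
by rewrite exprn_egt1// ltr1n.
Qed.

Lemma countable_control : exists z : nat -> E, forall A, measurable A ->
  (forall k, Q (z k) A = 0%E) -> forall y, Q y A = 0%E.
Proof.
have /choice[s sP] (n : nat) := @finite_uniform_control n.+1%:R^-1
  ltac:(by rewrite invr_gt0).
(* All the finite lists for [e = 1 / (n + 1)], enumerated through pairs of indices. Default values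
   merely add further points to the sequence. *)
exists (fun k => let ni := odflt (0, 0)%N (unpickle k) in nth point (s ni.1) ni.2).
move=> A mA zA y; apply/eqP; rewrite eq_le measure_ge0 andbT.
apply/lee_addgt0Pr => e e0; rewrite add0e.
near \oo => n.
have [t t0 /(_ A mA) st] := sP n.
apply/ltW/(lt_trans (st _ y)).
  move=> i _; have := zA (pickle (n, i)); rewrite pickleK/= => ->.
  by rewrite lte_fin.
by rewrite lte_fin; near: n; exact: near_infty_natSinv_lt (PosNum e0).
Unshelve. all: by end_near. Qed.

Lemma control_probability : exists nu : probability E R,
  forall A, measurable A -> nu A = 0%E -> forall y, Q y A = 0%E.
Proof.
have [z zP] := countable_control.
have [r r0 Qr] := kernel_bounded.
have w0 k : 0 <= (2 : R) ^- k.+1 by rewrite invr_ge0 exprn_ge0.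
pose w k : {nonneg R} := NngNum (w0 k).
pose m := mseries (fun k => mscale (w k) (Q (z k))) 0.
have moo : (m setT <= r%:E)%E.
  apply: nneseries_half_le => [|n|n]; first exact: ltW.
    exact: measure_ge0.
  rewrite -[leLHS]/((2 ^- n.+1)%:E * Q (z n) setT)%E muleC EFinM.
  rewrite lee_wpmul2r ?lee_fin ?invr_ge0 ?exprn_ge0//.
  exact: Qr.
(* Normalization falls back on a Dirac mass when [m] has total mass 0 or infinity; in the first case
   [m A = 0] holds anyway, and the bound [moo] excludes the second. *)
exists (mnormalize m (@dirac _ E point R)) => A mA nuA; apply: zP => // k.
have mA0 : m A = 0%E.
  have : @mnormalize _ E R m (@dirac _ E point R) A = 0%E := nuA.
  rewrite /mnormalize; case: ifPn => [/orP[/eqP mT0|/eqP mToo] _|].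
  - by apply/eqP; rewrite eq_le measure_ge0 andbT -mT0 le_measure ?inE.
  - by have /lt_eqF/eqP/(_ mToo) := le_lt_trans moo (ltry r).
  - rewrite negb_or => /andP[mT0 mToo] /= /eqP.
    rewrite mule_eq0 => /orP[/eqP//|]; rewrite eqe invr_eq0 fine_eq0 ?(negbTE mT0)//.
    by rewrite ge0_fin_numE ?ltey.
have : (mscale (w k) (Q (z k)) A <= m A)%E.
  rewrite /m /mseries/= (@nneseriesD1 _ _ k)// leeDl//.
  exact: nneseries_ge0.
rewrite mA0 -[leLHS]/((2 ^- k.+1)%:E * Q (z k) A)%E => h.
apply/eqP; rewrite eq_le measure_ge0 andbT.
by move: h; rewrite -[X in (_ <= X)%E](mule0 (2 ^- k.+1)%:E) lee_pmul2l.
Qed.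

(** If no [t] worked for some [e], the counterexamples for [t = 2 ^- n.+1] would have a [nu]-null
    upper limit. It would be null for every [Q y], which [limsup_charging] forbids. *)
Lemma uniform_control : exists nu : probability E R,
  (forall A, measurable A -> nu A = 0%E -> forall y, Q y A = 0%E) /\
  forall e : R, 0 < e -> exists2 t : R, 0 < t &
    forall A, measurable A -> (nu A < t%:E)%E -> forall y, (Q y A < e%:E)%E.
Proof.
have [nu nu0] := control_probability; exists nu; split => // e e0.
apply: contrapT => /forall2NP H.
have {H} : forall n : nat, exists Ay : set E * E, [/\ measurable Ay.1,
    (nu Ay.1 < (2 ^- n.+1)%:E)%E & (e%:E <= Q Ay.2 Ay.1)%E].
  move=> n; have [|] := H (2 ^- n.+1); first by case; rewrite invr_gt0 exprn_gt0.
  move=> /existsNP[A] /not_implyP[mA] /not_implyP[nuA] /existsNP[y] /negP.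
  by rewrite -leNgt => yA; exists (A, y).
move=> /choice[f fP].
have mA n : measurable (f n).1 by have [] := fP n.
have [] := @Qls (fun n => (f n).1) (fun n => (f n).2) e mA e0.
  by move=> n; have [] := fP n.
move=> n /eqP; apply; apply: nu0.
  by apply: bigcap_measurable => // k _; exact: bigcup_measurable.
apply: (@limsup_null _ _ 1) => // k.
by rewrite mul1r; apply: ltW; have [] := fP k.
Qed.

End control_measure.

(** * Jointly measurable density *)

Section dense_sets.
Context d (E : measurableType d).

(* The Boolean algebra generated by the sets g n, indexed by a countable type:
   an inner node denotes the complement of the union of its children. *)
Fixpoint tree_set (g : nat -> set E) (t : GenTree.tree nat) : set E :=
  match t with
  | GenTree.Leaf n => g n
  | GenTree.Node _ l => ~` (foldr (fun t B => tree_set g t `|` B) set0 l)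
  end.

Lemma measurable_tree_set g t : (forall n, measurable (g n)) ->
  measurable (tree_set g t).
Proof.
move=> mg; move: t; fix IH 1 => -[n|_ l] /=; first exact: mg.
apply: measurableC; elim: l => [|t l ihl] /=; first exact: measurable0.
by apply: measurableU; [exact: IH|exact: ihl].
Qed.

(** The sets that can be approximated by members of the generated algebra form a sigma-algebra
    containing [G]. The algebra is countable because its trees are. *)
Lemma countable_dense_sets (R : realType) : countably_generated E ->
  exists C : nat -> set E, (forall n, measurable (C n)) /\
    forall (m : {finite_measure set E -> \bar R}) (B : set E) (e : R),
      measurable B -> 0 < e ->
      exists n, (m ((B `\` C n) `|` (C n `\` B)) < e%:E)%E.
Proof.
move=> [G /countable_injP[f finj] mG].
(* An enumeration of [G] that inverts the injection [f], with the empty set at the indices that [f]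
   does not reach. *)
pose g n := xget set0 [set A | G A /\ f A = n].
have Gm A : G A -> measurable A by move=> GA; rewrite mG; exact: sub_gen_smallest.
have mg n : measurable (g n).
  by rewrite /g; case: xgetP => [A -> [/Gm]|_].
have gG A : G A -> g (f A) = A.
  move=> GA; rewrite /g; case: xgetP => [B -> [GB fBA]|/(_ A)[]//].
  by apply: finj; rewrite ?inE.
pose S := tree_set g.
have mS t : measurable (S t) by exact: measurable_tree_set.
pose C n := S (odflt (GenTree.Leaf 0%N) (unpickle n)).
exists C; split=> [n|m B e mB e0]; first exact: mS.
suff [t tP] : exists t, (m ((B `\` S t) `|` (S t `\` B)) < e%:E)%E.
  by exists (pickle t); rewrite /C pickleK.
pose D A := measurable A /\ forall e : R, 0 < e ->
  exists t, (m ((A `\` S t) `|` (S t `\` A)) < e%:E)%E.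
have mD A t : measurable A -> measurable ((A `\` S t) `|` (S t `\` A)).
  by move=> mA; apply: measurableU; apply: measurableD.
suff: <<s G >> `<=` D by move=> /(_ B); rewrite -mG => /(_ mB)[_]; exact.
have D0 : D set0.
  (* A childless node denotes the whole space, so its complement denotes the empty set. *)
  split=> // r r0; exists (GenTree.Node 0%N [:: GenTree.Node 0%N [::]]).
  by rewrite /S/= setU0 setC0 setCT setD0 setU0 measure0 lte_fin.
have DU A1 A2 : D A1 -> D A2 -> D (A1 `|` A2).
  move=> [mA1 A1P] [mA2 A2P]; split=> [|r r0]; first exact: measurableU.
  have r20 : 0 < r / 2 by rewrite divr_gt0.
  have [t1 t1P] := A1P _ r20; have [t2 t2P] := A2P _ r20.
  exists (GenTree.Node 0%N [:: GenTree.Node 0%N [:: t1; t2]]).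
  have -> : S (GenTree.Node 0%N [:: GenTree.Node 0%N [:: t1; t2]]) = S t1 `|` S t2.
    by rewrite /S/= setU0 setCK setU0.
  rewrite [r]splitr EFinD; apply: le_lt_trans (lteD t1P t2P).
  apply: (@le_trans _ _ (m (((A1 `\` S t1) `|` (S t1 `\` A1)) `|`
                            ((A2 `\` S t2) `|` (S t2 `\` A2))))%E).
    rewrite le_measure ?inE//.
    - by apply: measurableU; apply: measurableD; apply: measurableU.
    - by apply: measurableU; apply: mD.
    - by move=> y /=; tauto.
  by apply: measureU2; apply: mD.
apply: smallest_sub; last first.
  move=> A GA; split=> [|r r0]; first exact: Gm.
  by exists (GenTree.Leaf (f A)); rewrite /S/= gG// setDv setU0 measure0 lte_fin.
split => //.
  move=> A [mA AP]; rewrite setTD; split=> [|r r0]; first exact: measurableC.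
  have [t tP] := AP _ r0; exists (GenTree.Node 0%N [:: t]).
  suff -> : (~` A `\` S (GenTree.Node 0%N [:: t])) `|`
            (S (GenTree.Node 0%N [:: t]) `\` ~` A) =
            (A `\` S t) `|` (S t `\` A) by [].
  rewrite {1 2}/S/= setU0 -/(S t) !setDE !setCK setUC.
  by congr (_ `|` _); rewrite setIC.
move=> A AD.
have mA n : measurable (A n) by have [] := AD n.
have mU : measurable (\bigcup_k A k) by exact: bigcup_measurable.
split=> // r r0.
have r20 : 0 < r / 2 by rewrite divr_gt0.
(* A countable union is first truncated to a finite one, up to mass [r / 2], and the finite union is
   then approximated by a tree. *)
pose U n := \big[setU/set0]_(i < n) A i.
have DUn n : D (U n).
  by rewrite /U; apply: (big_ind D).
have mUn n : measurable (U n) by have [] := DUn n.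
have : (m \o (fun n => (\bigcup_k A k) `\` U n)) n @[n --> \oo] -->
    m (\bigcap_n ((\bigcup_k A k) `\` U n)).
  apply: nonincreasing_cvg_mu.
  - by rewrite ltey_eq fin_num_measure//; exact: measurableD.
  - by move=> i; exact: measurableD.
  - by apply: bigcap_measurable => // k _; exact: measurableD.
  - move=> i j ij; apply/subsetPset; apply: setDS.
    by apply: subset_bigsetU.
rewrite [X in m X](_ : _ = set0); last first.
  apply/seteqP; split=> // y yU; have [[k _ Aky] _] := yU 0%N Logic.I.
  have [_] := yU k.+1 Logic.I; apply.
  by rewrite /U -bigcup_mkord; exists k => /=.
rewrite measure0 => /fine_cvgP[_] /cvgr_lt/(_ _ r20)[N _ /(_ N (leqnn N))/= UN].
have [t tP] := (DUn N).2 _ r20.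
exists t; rewrite [r]splitr EFinD.
have UN' : (m ((\bigcup_k A k) `\` U N) < (r / 2)%:E)%E.
  by rewrite -(fineK (fin_num_measure m _ _)) ?lte_fin//; exact: measurableD.
apply: le_lt_trans (lteD UN' tP).
apply: (@le_trans _ _ (m (((\bigcup_k A k) `\` U N) `|`
                          ((U N `\` S t) `|` (S t `\` U N))))%E).
  rewrite le_measure ?inE//.
  - exact: mD.
  - by apply: measurableU; [exact: measurableD|exact: mD].
  - have UA : U N `<=` \bigcup_k A k.
      by rewrite /U -bigcup_mkord; apply: bigcup_sub => k _; exact: bigcup_sup.
    by move=> y /=; have := UA y; have := pselect (U N y); tauto.
by apply: measureU2; [exact: measurableD|exact: mD].
Qed.

End dense_sets.

(** * Integrable functions and a countable dense family *)

Section L1_toolkit.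
Import HBSimple.
Context d (E : measurableType d) (R : realType).
Variable m : {finite_measure set E -> \bar R}.
Implicit Types f g : E -> R.

Local Notation L1 f := (m.-integrable [set: E] (EFin \o f)).

Lemma L1_measurable f : L1 f -> measurable_fun setT f.
Proof. by move=> /integrableP[/measurable_EFinP]. Qed.

Lemma L1_indic A : measurable A -> L1 (\1_A : E -> R).
Proof. exact: integrable_indic. Qed.

Lemma L1D f g : L1 f -> L1 g -> L1 (fun x => f x + g x).
Proof. by move=> If Ig; exact: (integrableD measurableT If Ig). Qed.

Lemma L1B f g : L1 f -> L1 g -> L1 (fun x => f x - g x).
Proof. by move=> If Ig; exact: (integrableB measurableT If Ig). Qed.

Lemma L1Z c f : L1 f -> L1 (fun x => c * f x).
Proof. by move=> If; exact: (integrableZl measurableT c If). Qed.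

Lemma L1_abs f : L1 f -> L1 (fun x => `|f x|).
Proof. exact: integrable_norm. Qed.

Lemma L1_sum (I : Type) (s : seq I) (h : I -> E -> R) :
  (forall i, L1 (h i)) -> L1 (fun x => \sum_(i <- s) h i x).
Proof.
move=> Ih; elim: s => [|i s ih].
  under eq_fun do rewrite big_nil.
  exact: (finite_measure_integrable_cst m 0 measurableT).
by under eq_fun do rewrite big_cons; exact: L1D.
Qed.

Lemma L1_bounded f M : measurable_fun setT f -> (forall x, `|f x| <= M) -> L1 f.
Proof.
move=> mf fM; apply: measurable_bounded_integrable => //.
  by rewrite ltey_eq fin_num_measure.
by exists M; split; [exact: num_real|move=> y My x _; exact: le_trans (fM x) (ltW My)].
Qed.

Lemma Rintegral_sum (I : Type) (s : seq I) (h : I -> E -> R) :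
  (forall i, L1 (h i)) ->
  \int[m]_x (\sum_(i <- s) h i x) = \sum_(i <- s) \int[m]_x h i x.
Proof.
move=> Ih; elim: s => [|i s ih].
  rewrite big_nil; under eq_Rintegral do rewrite big_nil.
  by rewrite Rintegral_cst// mul0r.
rewrite big_cons -ih -RintegralD//; last exact: L1_sum.
by apply: eq_Rintegral => x _; rewrite big_cons.
Qed.

Lemma le_Rintegral_absD f g h : L1 f -> L1 g -> L1 h ->
  (forall x, `|h x| <= `|f x| + `|g x|) ->
  \int[m]_x `|h x| <= \int[m]_x `|f x| + \int[m]_x `|g x|.
Proof.
move=> If Ig Ih hfg; rewrite -RintegralD//; [|exact: L1_abs..].
apply: le_Rintegral => //; first exact: L1_abs.
by apply: L1D; exact: L1_abs.
Qed.

Lemma Rintegral_indicZ c A : measurable A ->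
  \int[m]_x (c * \1_A x) = c * fine (m A).
Proof.
move=> mA; rewrite RintegralZl//; last exact: L1_indic.
by rewrite /Rintegral integral_indic// setIT.
Qed.

Lemma Rintegral_setE A f : measurable A ->
  \int[m]_(x in A) f x = \int[m]_x (f x * \1_A x).
Proof.
move=> mA; rewrite Rintegral_mkcond; apply: eq_Rintegral => x _.
by rewrite /patch indicE; case: ifP; rewrite ?mulr1 ?mulr0.
Qed.

Lemma L1_indicM A f : measurable A -> L1 f -> L1 (fun x => f x * \1_A x).
Proof.
move=> mA If; apply: (le_integrable measurableT _ _ If).
  apply/measurable_EFinP/measurable_funM; first exact: L1_measurable.
  exact: measurable_indic.
move=> x _ /=; rewrite lee_fin normrM ler_piMr// indicE.
by case: (_ \in _); rewrite ?normr1 ?normr0.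
Qed.

(** An integrable function is an L1 limit of simple functions, each of which is a finite sum of
    scaled indicators of its level sets. *)
Lemma L1_simple_ind (P : (E -> R) -> Prop) :
  (forall A c, measurable A -> P (fun x => c * \1_A x)) ->
  (forall f g, L1 f -> L1 g -> P f -> P g -> P (fun x => f x + g x)) ->
  (forall f, L1 f -> (forall e : R, 0 < e ->
    exists2 g, L1 g & P g /\ \int[m]_x `|f x - g x| < e) -> P f) ->
  forall f, L1 f -> P f.
Proof.
move=> P1 PD Plim f If; apply: (Plim _ If) => e e0.
have [g [Ig _ fg]] := approximation_sfun_integrable measurableT If.
move: fg => /fine_cvgP[_] /cvgr_lt/(_ _ e0)[N _ /(_ N (leqnn N))/= gN].
exists (g N); first exact: Ig.
split; last by [].
have -> : (g N : E -> R) = fun x =>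
    \sum_(c <- finmap.enum_fset (fset_set (range (g N)))) c * \1_((g N) @^-1` [set c]) x.
  by apply/funext => x; rewrite {1}fimfunE fsbig_finite.
have mA c : measurable ((g N) @^-1` [set c]) by exact: measurable_sfunP.
elim: (finmap.enum_fset _) => [|c s ih].
  rewrite (_ : (fun x => _) = fun x => 0 * \1_(set0 : set E) x); first exact: P1.
  by apply/funext => x; rewrite big_nil mul0r.
under eq_fun do rewrite big_cons.
apply: (PD _ _ _ _ (P1 _ _ (mA c)) ih); first by apply: L1Z; exact: L1_indic.
by apply: L1_sum => i; apply: L1Z; exact: L1_indic.
Qed.

(** Rational coefficients and indices of sets make the type of parameters countable. *)
Definition rat_simple (C : nat -> set E) (l : seq (rat * nat)) (y : E) : R :=
  \sum_(qn <- l) ratr qn.1 * \1_(C qn.2) y.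

Lemma L1_rat_simple C l : (forall n, measurable (C n)) -> L1 (rat_simple C l).
Proof. by move=> mC; apply: L1_sum => i; apply: L1Z; exact: L1_indic. Qed.

Lemma dense_rat_simple (C : nat -> set E) :
  (forall n, measurable (C n)) ->
  (forall B (e : R), measurable B -> 0 < e ->
      exists n, (m ((B `\` C n) `|` (C n `\` B)) < e%:E)%E) ->
  forall f, L1 f -> forall e : R, 0 < e ->
  exists l, \int[m]_x `|f x - rat_simple C l x| < e.
Proof.
move=> mC denseC; have IS l := L1_rat_simple l mC.
apply: L1_simple_ind => [A c mA e e0|f g If Ig Pf Pg e e0|f If Pf e e0].
- have e20 : 0 < e / 2 by rewrite divr_gt0.
  have c0 : 0 < `|c| + 1 by rewrite ltr_wpDl.
  have M0 : 0 < fine (m setT) + 1 by rewrite ltr_wpDl// fine_ge0.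
  (* The error splits as [c (1_A - 1_(C n)) + (c - q) 1_(C n)]. The tolerances bring each term to at
     most [e / 2], and the [+ 1] keeps the denominators positive. *)
  have [n An] := denseC A (e / 2 / (`|c| + 1)) mA (divr_gt0 e20 c0).
  have d0 : 0 < e / 2 / (fine (m setT) + 1) by rewrite divr_gt0.
  have cd : c < c + e / 2 / (fine (m setT) + 1) by rewrite ltrDl.
  have [q] := rat_in_itvoo cd.
  rewrite in_itv/= => /andP[cq qc].
  exists [:: (q, n)].
  pose D := (A `\` C n) `|` (C n `\` A).
  have mD : measurable D by apply: measurableU; exact: measurableD.
  have cqle : `|c - ratr q| <= e / 2 / (fine (m setT) + 1).
    by rewrite distrC ger0_norm ?subr_ge0 1?ltW// ltrBlDl.
  apply: (@le_lt_trans _ _ (\int[m]_x `| `|c| * \1_D x | +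
      \int[m]_x `| `|c - ratr q| * \1_(setT : set E) x |)).
    apply: le_Rintegral_absD.
    + by apply: L1Z; exact: L1_indic.
    + by apply: L1Z; exact: L1_indic.
    + by apply: L1B => //; apply: L1Z; exact: L1_indic.
    move=> x; rewrite /rat_simple big_seq1/= indicT mulr1.
    rewrite !normrM !normr_id.
    have -> : c * \1_A x - ratr q * \1_(C n) x =
        c * (\1_A x - \1_(C n) x) + (c - ratr q) * \1_(C n) x by ring.
    rewrite (le_trans (ler_normD _ _))// !normrM lerD//.
      rewrite ler_wpM2l// /D !indicE in_setU !in_setD.
      case: (x \in A); case: (x \in C n);
        by rewrite /= ?subrr ?subr0 ?sub0r ?normrN ?normr1 ?normr0.
    by rewrite ler_piMr// indicE; case: (_ \in _); rewrite ?normr1 ?normr0.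
  rewrite [e in ltRHS]splitr ltr_leD//.
    under eq_Rintegral do rewrite normrM normr_id (@ger0_norm _ (\1_ _ _))//.
    rewrite Rintegral_indicZ//.
    move: An; rewrite -/D -(fineK (fin_num_measure m _ mD)) lte_fin => An.
    apply: (@le_lt_trans _ _ ((`|c| + 1) * fine (m D))).
      by apply: ler_wpM2r; [exact: (fine_ge0 (measure_ge0 m _))|rewrite lerDl].
    by rewrite mulrC -ltr_pdivlMr.
  under eq_Rintegral do rewrite normrM normr_id (@ger0_norm _ (\1_ _ _))//.
  rewrite Rintegral_indicZ// (le_trans (ler_wpM2r (fine_ge0 (measure_ge0 m _)) cqle))//.
  by rewrite mulrAC ler_pdivrMr// ler_wpM2l ?lerDl// ltW.
- have e20 : 0 < e / 2 by rewrite divr_gt0.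
  have [l1 l1P] := Pf _ e20; have [l2 l2P] := Pg _ e20.
  exists (l1 ++ l2); rewrite [e]splitr; apply: le_lt_trans (ltrD l1P l2P).
  apply: le_Rintegral_absD => //.
  + exact: L1B.
  + exact: L1B.
  + by apply: L1B => //; exact: L1D.
  move=> x; rewrite /rat_simple big_cat/= -/(rat_simple C l1 x) -/(rat_simple C l2 x).
  by rewrite opprD addrACA ler_normD.
- have e20 : 0 < e / 2 by rewrite divr_gt0.
  have [g Ig [Pg fg]] := Pf _ e20; have [l gl] := Pg _ e20.
  exists l; rewrite [e]splitr; apply: le_lt_trans (ltrD fg gl).
  apply: le_Rintegral_absD => //; [exact: L1B..|].
  by move=> x; rewrite -[f x - rat_simple C l x](subrKA (g x)) ler_normD.
Qed.

(** The bound is applied to the set where [h] is nonnegative and to its complement. *)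
Lemma Rintegral_abs_le (h : E -> R) (a : R) : L1 h ->
  (forall B, measurable B -> `|\int[m]_(x in B) h x| <= a) ->
  \int[m]_x `|h x| <= a *+ 2.
Proof.
move=> Ih hB.
pose P := [set x | 0 <= h x].
have mP : measurable P.
  rewrite -[P]setTI; apply: measurable_fun_le => //; exact: L1_measurable.
have -> : \int[m]_x `|h x| = \int[m]_(x in P) h x - \int[m]_(x in ~` P) h x.
  rewrite (Rintegral_setE _ mP) (Rintegral_setE _ (measurableC mP)).
  rewrite -RintegralB//; [|apply: L1_indicM => //; exact: measurableC..].
  apply: eq_Rintegral => x _; rewrite -mulrBr !indicE in_setC /P.
  have [h0|h0] := leP 0 (h x).
    by rewrite mem_set//= subr0 mulr1 ger0_norm.
  by rewrite memNset/= ?sub0r ?mulrN1 ?ltr0_norm//; apply/negP; rewrite -ltNge.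
rewrite mulr2n (le_trans (ler_norm _))// (le_trans (ler_normB _ _))//.
by rewrite lerD// hB//; exact: measurableC.
Qed.

(** Absolute continuity of the integral of [|h|] carries the bound from the sets [C n] to all
    measurable sets. Countably many conditions thus control an L1 norm. *)
Lemma Rintegral_abs_dense (C : nat -> set E) (h : E -> R) (a : R) :
  (forall n, measurable (C n)) ->
  (forall B (e : R), measurable B -> 0 < e ->
      exists n, (m ((B `\` C n) `|` (C n `\` B)) < e%:E)%E) ->
  L1 h -> (forall n, `|\int[m]_(x in C n) h x| <= a) ->
  \int[m]_x `|h x| <= a *+ 2.
Proof.
move=> mC denseC Ih hC.
apply: Rintegral_abs_le => // B mB; apply/ler_addgt0Pr => e e0.
have [t [t0 tP]] := integral_normr_continuous Ih e0.
have [n Bn] := denseC B t mB t0.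
pose D := (B `\` C n) `|` (C n `\` B).
have mD : measurable D by apply: measurableU; exact: measurableD.
have hD := tP _ mD Bn.
rewrite -(subrK (\int[m]_(x in C n) h x) (\int[m]_(x in B) h x)) addrC.
rewrite (le_trans (ler_normD _ _))// lerD//.
rewrite (Rintegral_setE _ mB) (Rintegral_setE _ (mC n)).
rewrite -RintegralB//; [|exact: L1_indicM..].
apply: (le_trans (le_normr_Rintegral _ _)) => //.
  by apply: L1B; exact: L1_indicM.
apply/ltW/(le_lt_trans _ hD); rewrite (Rintegral_setE _ mD).
apply: le_Rintegral => //.
+ by apply: L1_abs; apply: L1B; exact: L1_indicM.
+ by apply: L1_indicM => //; exact: L1_abs.
move=> x _; rewrite -mulrBr normrM ler_wpM2l// /D !indicE in_setU !in_setD.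
case: (x \in B); case: (x \in C n);
  by rewrite /= ?subrr ?subr0 ?sub0r ?normrN ?normr1 ?normr0.
Qed.

End L1_toolkit.

Section joint_density.
Context d (E : measurableType d) (R : realType).

(** The sum of all errors [|f - u k|] has integral at most [c], so it is finite almost everywhere;
    there its tails, which dominate the single errors, tend to 0. *)
Lemma L1_fast_cvg (m : {finite_measure set E -> \bar R}) (f : E -> R)
    (u : nat -> E -> R) (c : R) : 0 <= c ->
  m.-integrable setT (EFin \o f) -> (forall k, m.-integrable setT (EFin \o u k)) ->
  (forall k, \int[m]_x `|f x - u k x| <= c / 2 ^+ k.+1) ->
  {ae m, forall x, u k x @[k --> \oo] --> f x}.
Proof.
move=> c0 If Iu fu.
pose g k x : \bar R := (`|f x - u k x|)%:E.
have Ig k : m.-integrable setT (g k) by apply: L1_abs; exact: L1B.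
have mg k : measurable_fun setT (g k) by exact: measurable_int (Ig k).
have g0 k x : (0 <= g k x)%E by rewrite lee_fin.
have mF : measurable_fun setT (fun x => (\sum_(k <oo) g k x)%E).
  exact: ge0_emeasurable_sum.
have IF : m.-integrable setT (fun x => (\sum_(k <oo) g k x)%E).
  apply/integrableP; split => //.
  under eq_integral do rewrite gee0_abs ?nneseries_ge0//.
  rewrite integral_nneseries//.
  apply: (@le_lt_trans _ _ c%:E); last exact: ltry.
  apply: nneseries_half_le => // k; first exact: integral_ge0.
  rewrite -[leLHS]fineK; first by rewrite lee_fin; exact: fu.
  by apply: integrable_fin_num => //; exact: Ig.
have := integrable_ae measurableT IF; apply: filterS => x /(_ Logic.I) Fx.
have : (\sum_(k <= i <oo) g i x)%E @[k --> \oo] --> 0%E.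
  by apply: nneseries_tail_cvg => //; rewrite ltey_eq Fx.
move=> /fine_cvgP[[M _ Mfin] /cvgr_lt tail0].
apply/cvgrPdist_lt => e e0; have [N _ Ne] := tail0 e e0.
exists (maxn M N) => // k /=; rewrite geq_max => /andP[Mk Nk].
apply: le_lt_trans (Ne k Nk); rewrite -lee_fin fineK; last exact: Mfin.
have := @nneseries_lim_ge R (fun i => g i x) xpredT k k.+1 (fun i _ _ => g0 i x).
by rewrite big_nat1.
Qed.

Lemma kernel_density (Q : R.-fker E ~> E) (nu : probability E R) (x : E) :
  (forall A, measurable A -> nu A = 0%E -> Q x A = 0%E) ->
  exists f : E -> R, [/\ forall y, 0 <= f y,
    nu.-integrable setT (EFin \o f) &
    forall A, measurable A -> Q x A = (\int[nu]_(y in A) (f y)%:E)%E].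
Proof.
move=> Qnu.
(* Integrating the kernel against the Dirac mass at [x] gives [Q x] the structure of a finite
   measure. *)
pose q : {finite_measure set E -> \bar R} :=
  kernel_integral Q (@dirac _ E x R).
have qE A : measurable A -> q A = Q x A.
  move=> mA; rewrite /q /kernel_integral/= integral_dirac//.
    by rewrite diracT mul1e.
  exact: measurable_kernel.
have qnu : q `<< nu by apply/null_content_dominatesP => A mA ?; rewrite qE// Qnu.
have [g [g0 gfin gint gE]] := radon_nikodym_sigma_finite qnu.
have gK : EFin \o (fine \o g) = g by apply/funext => y /=; rewrite fineK.
exists (fine \o g); split; first by move=> y; exact: fine_ge0.
  by rewrite gK.
by move=> A mA; rewrite -qE// gE//; apply: eq_integral => y _; rewrite /= fineK.
Qed.

Variables (Q : R.-fker E ~> E) (nu : probability E R).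
Hypothesis hE : countably_generated E.
Hypothesis Qnu : forall A, measurable A -> nu A = 0%E -> forall y, Q y A = 0%E.

(* For each x, the density of Q x is the almost sure limit of functions taken
   from a countable L1-dense family; choosing at step k the first member whose
   integrals over a dense sequence of sets are 2^-k-close to those of Q x makes
   the choice measurable in x. *)
Lemma joint_density : exists alpha : E * E -> R, [/\ forall z, 0 <= alpha z,
  measurable_fun setT alpha &
  forall x A, measurable A -> Q x A = density_kernel nu alpha x A].
Proof.
have [C [mC denseC]] := countable_dense_sets R hE.
pose S j : E -> R := rat_simple R C (odflt [::] (unpickle j)).
have IS j : nu.-integrable setT (EFin \o S j) by exact: L1_rat_simple.
have /choice[f fP] x := @kernel_density Q nu x (fun A mA A0 => Qnu mA A0 x).
have If x : nu.-integrable setT (EFin \o f x) by have [] := fP x.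
have fE x A : measurable A -> fine (Q x A) = \int[nu]_(y in A) f x y.
  by move=> mA; have [_ _ ->] := fP x.
(* Only countably many conditions, each measurable in [x]; the boolean form allows taking the least
   good index. *)
pose good k x j := `[< forall n,
  `|\int[nu]_(y in C n) S j y - fine (Q x (C n))| <= 2 ^- k >].
have ex_good k x : exists j, good k x j.
  have e0 : 0 < (2 : R) ^- k by rewrite invr_gt0 exprn_gt0.
  have [l lP] := dense_rat_simple mC (denseC nu) (If x) e0.
  exists (pickle l); apply/asboolP => n; rewrite fE// /S pickleK/=.
  have Il : nu.-integrable setT (EFin \o rat_simple R C l) by exact: L1_rat_simple.
  rewrite !(Rintegral_setE _ _ (mC n)).
  rewrite -RintegralB//; [|exact: L1_indicM..].
  apply: (le_trans (le_normr_Rintegral _ _)) => //.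
    by apply: L1B; exact: L1_indicM.
  apply/ltW/(le_lt_trans _ lP); apply: le_Rintegral => //.
  - by apply: L1_abs; apply: L1B; exact: L1_indicM.
  - by apply: L1_abs; exact: L1B.
  move=> y _; rewrite -mulrBl normrM distrC ler_piMr// indicE.
  by case: (_ \in _); rewrite ?normr1 ?normr0.
pose idx k x := ex_minn (ex_good k x).
have mgood k j : measurable [set x | good k x j].
  rewrite (_ : [set x | good k x j] = \bigcap_n [set x |
      `|\int[nu]_(y in C n) S j y - fine (Q x (C n))| <= 2 ^- k]); last first.
    apply/seteqP; split => x /=.
      by move=> /asboolP h n _; exact: h.
    by move=> h; apply/asboolP => n; exact: h.
  apply: bigcap_measurable => // n _.
  rewrite -[X in measurable X]setTI; apply: measurable_fun_le => //.
  apply: measurableT_comp => //; apply: measurable_funB => //.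
  by apply: measurableT_comp => //; exact: measurable_kernel.
have midx k j : measurable [set x | idx k x = j].
  rewrite (_ : [set x | idx k x = j] = [set x | good k x j] `&`
      \bigcap_(i in [set i | (i < j)%N]) ~` [set x | good k x i]).
    apply: measurableI; first exact: mgood.
    have [-> |j0] := eqVneq j 0%N.
      by rewrite (_ : [set _ | _] = set0) ?bigcap_set0//; apply/seteqP; split.
    apply: bigcap_measurable; first by exists 0%N; rewrite /= lt0n.
    by move=> i _; apply: measurableC; exact: mgood.
  apply/seteqP; split => x /=; rewrite /idx; case: ex_minnP => n gn nmin.
    by move=> <-; split => // i /= + gi; rewrite ltnNge nmin.
  move=> [gj jmin]; apply/eqP; rewrite eqn_leq nmin//= leqNgt.
  by apply/negP => nj; exact: (jmin n nj).
pose u k (z : E * E) : \bar R := (S (idx k z.1) z.2)%:E.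
have mu k : measurable_fun setT (u k).
  move=> _ Y mY; rewrite setTI.
  rewrite (_ : u k @^-1` Y = \bigcup_j ([set x | idx k x = j] `*`
      ((EFin \o S j) @^-1` Y))).
    apply: bigcupT_measurable => j; apply: measurableX; first exact: midx.
    by rewrite -[X in measurable X]setTI; apply: (measurable_int nu (IS j)).
  apply/seteqP; split => [[x y] /= uxy|[x y] [j _] []/= <- //].
  by exists (idx k x).
(* The upper limit is measurable whether or not the sequence converges; [fine] and the maximum with
   0 keep the function finite and nonnegative without changing it where the limit is the density. *)
pose alpha z := Num.max 0 (fine (limn_esup (u ^~ z))).
have malpha : measurable_fun setT alpha.
  apply: (@measurable_maxr _ _ _ _ (cst 0)) => //.
  apply: measurableT_comp; first exact: fine_measurable.
  exact: measurable_fun_limn_esup.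
exists alpha; split => //; first by move=> z; rewrite /alpha le_max lexx.
move=> x A mA; have [f0 _ ->//] := fP x.
have {}malpha : measurable_fun setT (fun y => (alpha (x, y))%:E).
  by apply/measurable_EFinP; exact: measurable_fun_pair2 malpha.
apply: ge0_ae_eq_integral => //.
- exact: measurable_funTS (measurable_int nu (If x)).
- exact: measurable_funTS malpha.
- by move=> y _; rewrite lee_fin.
- by move=> y _; rewrite lee_fin /alpha le_max lexx.
have : {ae nu, forall y, S (idx k x) y @[k --> \oo] --> f x y}.
  (* Being [2 ^- k]-close on the sets [C n] gives an L1 distance of at most twice that, which equals
     [4 / 2 ^+ k.+1]. *)
  apply: (@L1_fast_cvg nu (f x) (fun k => S (idx k x)) 4) => // k.
  have ->  : (4 : R) / 2 ^+ k.+1 = 2 ^- k *+ 2.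
    have : (2 : R) ^+ k != 0 by rewrite expf_neq0// pnatr_eq0.
    by rewrite exprS; move: (2 ^+ k) => t t0; field.
  under eq_Rintegral do rewrite distrC.
  apply: (Rintegral_abs_dense mC (denseC nu)).
    exact: L1B.
  move=> n.
  have -> : \int[nu]_(y in C n) (S (idx k x) y - f x y) =
      \int[nu]_(y in C n) S (idx k x) y - fine (Q x (C n)).
    rewrite fE// RintegralB//; apply: integrableS (_ : nu.-integrable setT _) => //.
  by rewrite /idx; case: ex_minnP => j /asboolP + _; exact.
apply: filterS => y Sf _.
rewrite /alpha; congr EFin.
have -> : limn_esup (u ^~ (x, y)) = (f x y)%:E.
  have cu : u ^~ (x, y) @ \oo --> (f x y)%:E by apply: cvg_EFin => //; apply: nearW.
  by rewrite is_cvg_limn_esupE; [exact/cvg_lim|apply/cvg_ex; exists (f x y)%:E].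
by rewrite /= max_r.
Qed.

End joint_density.

(** * From weak compactness to a uniformly integrable density *)

Section weakly_compact_Kstar.
Context d (E : measurableType d) (R : realType) (Q : R.-fker E ~> E).

Lemma cvg_pinfty_ge0 (F : R -> \bar R) : (forall m, (0 <= F m)%E) ->
  (forall e : R, 0 < e -> \forall m \near +oo, (F m <= e%:E)%E) ->
  F m @[m --> +oo] --> 0%E.
Proof.
move=> F0 Fe; apply/fine_cvgP; split.
  have := Fe 1 ltr01; apply: filterS => m F1.
  by rewrite ge0_fin_numE// (le_lt_trans F1)// ltry.
apply/cvgrPdist_le => e e0; have := Fe e e0; apply: filterS => m Fm /=.
rewrite sub0r normrN ger0_norm ?fine_ge0//.
rewrite -lee_fin fineK; first exact: Fm.
by rewrite ge0_fin_numE// (le_lt_trans Fm)// ltry.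
Qed.

Lemma weakly_compact_Kstar : countably_generated E ->
  weakly_sequentially_compact
    (kernel_adjoint Q @` [set mu : complex_measure E R | `|mu| <= 1]) ->
  Kstar Q.
Proof.
move=> hE /weakly_compact_kernel_limsup wc.
have [nu [nu0 nuc]] := uniform_control wc.
have [alpha [alpha0 malpha QE]] := joint_density hE nu0.
exists nu, alpha; split => //; split => //.
have [r r0 Qr] := kernel_bounded Q.
have malpha_x x : measurable_fun setT (fun y => alpha (x, y)).
  exact: measurable_fun_pair2 malpha.
have mA m x : measurable [set y | m <= alpha (x, y)].
  by rewrite -[X in measurable X]setTI; apply: measurable_fun_le.
apply: cvg_pinfty_ge0 => [m|e e0].
  apply: le_trans (ereal_sup_ubound _); last by exists point.
  by apply: integral_ge0 => y _; rewrite lee_fin.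
(* By Markov's inequality the level set of [alpha (x, _)] above [m] has [nu]-mass at most [r / m],
   below [t] once [m > r / t], uniformly in [x]. Its [Q x]-mass, the integral to be bounded, is then
   below [e]. *)
have [t t0 nut] := nuc e e0.
near=> m.
have m0 : 0 < m by near: m; apply: nbhs_pinfty_gt; exact: num_real.
have rtm : r / t < m by near: m; apply: nbhs_pinfty_gt; exact: num_real.
apply: ge_ereal_sup => _ [x _ <-].
rewrite -/(density_kernel nu alpha x _) -QE//; apply/ltW/nut => //.
rewrite -(@lte_pmul2l _ m%:E)//.
apply: (@le_lt_trans _ _ r%:E); last first.
  by rewrite -EFinM lte_fin -ltr_pdivrMr.
apply: le_trans (Qr x _ (mA m x)); rewrite QE// /density_kernel.
rewrite -integral_cst//; apply: ge0_le_integral => //.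
- by move=> y _; rewrite lee_fin ltW.
- by apply/measurable_EFinP; exact: measurable_funTS.
Unshelve. all: by end_near. Qed.

End weakly_compact_Kstar.

(** * Setwise convergent subsequences *)

Section ac_charge.
Context d (E : measurableType d) (R : realType).
Variables (nu : probability E R) (L : set E -> R).
Hypothesis LU : forall A B, measurable A -> measurable B -> A `&` B = set0 ->
  L (A `|` B) = L A + L B.
Hypothesis Lac : forall e : R, 0 < e -> exists2 t : R, 0 < t &
  forall A, measurable A -> (nu A < t%:E)%E -> `|L A| <= e.

Definition ac_charge (A : set E) : \bar R := (L A)%:E.

Let L0 : L set0 = 0.
Proof.
have : L (set0 `|` set0) = L set0 + L set0.
  by apply: LU => //; rewrite setI0.
by rewrite setU0 => /eqP; rewrite -subr_eq0 opprD addNKr oppr_eq0 => /eqP.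
Qed.

(** What remains of the union after the first [n] sets has [nu]-mass tending to 0, so absolute
    continuity upgrades finite to countable additivity. *)
Let ac_charge_sigma_additive : semi_sigma_additive ac_charge.
Proof.
move=> F mF tF mU; rewrite /ac_charge.
pose U n := \big[setU/set0]_(i < n) F i.
have mUn n : measurable (U n) by exact: bigsetU_measurable.
have LUn n : \sum_(0 <= i < n) L (F i) = L (U n).
  elim: n => [|n ih]; first by rewrite big_nil /U big_ord0 L0.
  rewrite big_nat_recr//= ih /U big_ord_recr/= LU//.
    exact: mUn.
  rewrite -bigcup_mkord; apply/seteqP; split=> // y [[i /= iN Fi] Fn].
  have := tF i n Logic.I Logic.I (ex_intro _ y (conj Fi Fn)) => iN'.
  by rewrite iN' ltnn in iN.
apply: cvg_EFin; first by apply: nearW => n; rewrite sumEFin.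
rewrite [X in X @ _ --> _](_ : _ = fun n => L (U n)); last first.
  by apply/funext => n /=; rewrite sumEFin/= LUn.
apply/cvgrPdist_le => e e0; have [t t0 Lt] := Lac e0.
have : (nu \o (fun n => (\bigcup_k F k) `\` U n)) n @[n --> \oo] -->
    nu (\bigcap_n ((\bigcup_k F k) `\` U n)).
  apply: nonincreasing_cvg_mu.
  - by rewrite ltey_eq fin_num_measure//; exact: measurableD.
  - by move=> i; exact: measurableD.
  - by apply: bigcap_measurable => // k _; exact: measurableD.
  - move=> i j ij; apply/subsetPset; apply: setDS.
    by apply: subset_bigsetU.
rewrite [X in nu X](_ : _ = set0); last first.
  apply/seteqP; split=> // y yU; have [[k _ Aky] _] := yU 0%N Logic.I.
  have [_] := yU k.+1 Logic.I; apply.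
  by rewrite /U -bigcup_mkord; exists k => /=.
rewrite measure0 => /fine_cvgP[_] /cvgr_lt/(_ _ t0).
apply: filterS => n /= nun.
have mD : measurable ((\bigcup_k F k) `\` U n) by exact: measurableD.
have -> : L (\bigcup_k F k) = L (U n) + L ((\bigcup_k F k) `\` U n).
  rewrite -LU//; last by rewrite setDIK.
  rewrite setDUK// /U -bigcup_mkord.
  by apply: bigcup_sub => k _; exact: bigcup_sup.
rewrite addrAC subrr add0r; apply: Lt => //.
by rewrite -(fineK (fin_num_measure nu _ mD)) lte_fin.
Qed.

HB.instance Definition _ := isCharge.Build _ _ _ ac_charge
  (congr1 EFin L0) (fun _ _ => isT) ac_charge_sigma_additive.

Definition ac_charge_of : {charge set E -> \bar R} := ac_charge.

Lemma ac_charge_dominates : ac_charge_of `<< nu.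
Proof.
apply/null_content_dominatesP => A mA nuA; rewrite /= /ac_charge.
apply/eqP; rewrite eqe -normr_le0; apply/ler_addgt0Pr => e e0.
rewrite add0r; have [t t0 Lt] := Lac e0.
by apply: Lt => //; rewrite nuA lte_fin.
Qed.

End ac_charge.

(** Cantor's diagonal argument over successive Bolzano-Weierstrass extractions. *)
Lemma diagonal_cvg (R : realType) (u : nat -> nat -> R) :
  (forall j, exists K, forall n, `|u j n| <= K) ->
  exists2 s : nat -> nat, increasing_seq s & forall j, cvgn (u j \o s).
Proof.
move=> ub.
have BW (Sj : (nat -> nat) * nat) : exists f : nat -> nat,
    increasing_seq f /\ cvgn (u Sj.2 \o Sj.1 \o f).
  have [|f finc fcvg] := @bolzano_weierstrass R (u Sj.2 \o Sj.1).
    have [K uK] := ub Sj.2; exists K; split; first exact: num_real.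
    by move=> x Kx n _ /=; exact: le_trans (uK _) (ltW Kx).
  by exists f.
have /choice[F FP] := BW.
pose S := fix S j := if j is i.+1 then S i \o F (S i, i) else id.
have Finc j : increasing_seq (F (S j, j)) by have [] := FP (S j, j).
have Sinc j : increasing_seq (S j).
  by elim: j => [//|j ih] m n /=; rewrite ih; exact: Finc.
have Slt j m n : (m < n)%N -> (S j m < S j n)%N.
  by move/leqW_mono : (Sinc j) => ->.
pose s k := S k k.
(* Later extractions refine earlier ones and only push indices up. From rank [j.+1] on, the diagonal
   therefore runs inside [S j.+1], along which [u j] converges. *)
have SS j k m : (j <= k)%N -> exists2 n, (m <= n)%N & S k m = S j n.
  elim: k m => [|k ih] m; first by rewrite leqn0 => /eqP ->; exists m.
  rewrite leq_eqVlt => /predU1P[->|]; first by exists m.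
  rewrite ltnS => /(ih (F (S k, k) m)) [n mn Skn]; exists n => //.
  by apply: leq_trans mn; exact: increasing_seq_ge.
exists s.
  apply/increasing_seqP => n; rewrite ltEnat/= /s /=; apply: Slt.
  exact: increasing_seq_ge.
move=> j; have [_ /cvg_ex[l jl]] := FP (S j, j).
apply/cvg_ex; exists l; apply/cvgrPdist_lt => e e0.
move/cvgrPdist_lt : jl => /(_ e e0)[N _ Ne].
exists (maxn j.+1 N) => // k /=; rewrite geq_max => /andP[jk Nk].
have [n kn] := SS j.+1 k k jk; rewrite /s => ->.
by apply: Ne => /=; exact: leq_trans kn.
Qed.

Section setwise_subsequence.
Context d (E : measurableType d) (R : realType).
Variables (nu : probability E R) (c : nat -> {charge set E -> \bar R}).
Hypothesis cac : forall e : R, 0 < e -> exists2 t : R, 0 < t &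
  forall A, measurable A -> (nu A < t%:E)%E -> forall n, `|fine (c n A)| <= e.

Lemma fine_chargeU (m : {charge set E -> \bar R}) A B : measurable A ->
  measurable B -> A `&` B = set0 -> fine (m (A `|` B)) = fine (m A) + fine (m B).
Proof.
by move=> mA mB AB; rewrite chargeU// fineD// fin_num_measure.
Qed.

(** With [C j] close to [B], the values at [B] and at [C j] differ by at most [e / 4 + e / 4] for
    all [n] at once. The limit along [C j] is then eventually within [e] of the values at [B], which
    is a Cauchy criterion. *)
Lemma setwise_cvg_dense (C : nat -> set E) : (forall n, measurable (C n)) ->
  (forall B (e : R), measurable B -> 0 < e ->
      exists n, (nu ((B `\` C n) `|` (C n `\` B)) < e%:E)%E) ->
  (forall j, cvgn (fun n => fine (c n (C j)))) ->
  forall B, measurable B -> cvgn (fun n => fine (c n B)).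
Proof.
move=> mC denseC cvgC B mB; apply/cauchy_cvgP/cauchy_exP => e e0.
have e40 : 0 < e / 4 by rewrite divr_gt0.
have [t t0 ct] := cac e40.
have [j Bj] := denseC B t mB t0.
have /cvg_ex[l cl] := cvgC j.
exists l; move/cvgrPdist_lt : cl => /(_ (e / 2)) [|N _ Nl]; first by rewrite divr_gt0.
exists N => // n Nn; rewrite /ball/=.
have mD1 : measurable (B `\` C j) by exact: measurableD.
have mD2 : measurable (C j `\` B) by exact: measurableD.
have D1 : `|fine (c n (B `\` C j))| <= e / 4.
  apply: ct => //; apply: le_lt_trans Bj; rewrite le_measure ?inE//.
  exact: measurableU.
have D2 : `|fine (c n (C j `\` B))| <= e / 4.
  apply: ct => //; apply: le_lt_trans Bj; rewrite le_measure ?inE//.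
  exact: measurableU.
have BE : fine (c n B) = fine (c n (B `&` C j)) + fine (c n (B `\` C j)).
  rewrite -fine_chargeU//; [by rewrite setUIDK|exact: measurableI|].
  by apply/seteqP; split=> // y [[_ ?] []].
have CE : fine (c n (C j)) = fine (c n (B `&` C j)) + fine (c n (C j `\` B)).
  rewrite -fine_chargeU//; [by rewrite setIC setUIDK|exact: measurableI|].
  by apply/seteqP; split=> // y [[? _] []].
have := Nl n Nn; rewrite /= CE BE.
move: D1 D2; rewrite !ler_norml !ltr_norml => /andP[? ?] /andP[? ?] /andP[? ?].
by apply/andP; split; lra.
Qed.

End setwise_subsequence.

(** * Functionals on densities *)

Section L1_dual.
Context d (E : measurableType d) (R : realType) (nu : probability E R).
Implicit Types f g : E -> R.

Local Notation L1 f := (nu.-integrable [set: E] (EFin \o f)).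

Lemma L1M_bounded f g M : L1 f -> measurable_fun setT g ->
  (forall x, `|g x| <= M) -> L1 (fun x => f x * g x).
Proof.
move=> If mg gM.
apply: (le_integrable measurableT _ _ (L1Z M (L1_abs If))).
  by apply/measurable_EFinP/measurable_funM => //; exact: L1_measurable If.
move=> x _ /=; rewrite lee_fin !normrM normr_id mulrC ler_wpM2r//.
exact: le_trans (gM x) (ler_norm _).
Qed.

Section functional.
Variables (T : (E -> R) -> R) (K : R).
Hypothesis TD : forall f g, L1 f -> L1 g -> T (fun x => f x + g x) = T f + T g.
Hypothesis TZ : forall c f, L1 f -> T (fun x => c * f x) = c * T f.
Hypothesis TK : forall f, L1 f -> `|T f| <= K * \int[nu]_x `|f x|.

Let TB f g : L1 f -> L1 g -> T (fun x => f x - g x) = T f - T g.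
Proof.
move=> If Ig; rewrite (_ : (fun x => _) = fun x => f x + (-1) * g x).
  by rewrite TD ?TZ ?mulN1r//; exact: L1Z.
by apply/funext => x; rewrite mulN1r.
Qed.

Let T_indic A : measurable A -> `|T \1_A| <= K * fine (nu A).
Proof.
move=> mA; apply: (le_trans (TK (L1_indic _ mA))).
under eq_Rintegral do rewrite (@ger0_norm _ (\1_ _ _))//.
by rewrite /Rintegral integral_indic// setIT.
Qed.

Let K0 : 0 <= K.
Proof.
have := T_indic (@measurableT _ E); rewrite probability_setT mulr1.
exact: le_trans.
Qed.

Let T_additive A B : measurable A -> measurable B -> A `&` B = set0 ->
  T \1_(A `|` B) = T \1_A + T \1_B.
Proof.
move=> mA mB AB; rewrite -TD; [|exact: L1_indic..].
congr T; apply/funext => x; rewrite !indicE in_setU.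
have [xA|_] := boolP (x \in A); have [xB|_] := boolP (x \in B);
  rewrite /= ?addr0 ?add0r//.
have : (A `&` B) x by split; exact: set_mem.
by rewrite AB.
Qed.

Let T_ac e : 0 < e -> exists2 t : R, 0 < t &
  forall A, measurable A -> (nu A < t%:E)%E -> `|T \1_A| <= e.
Proof.
move=> e0; have K10 : 0 < K + 1 by rewrite ltr_wpDl.
exists (e / (K + 1)); first by rewrite divr_gt0.
move=> A mA nuA; apply: (le_trans (T_indic mA)).
apply: (@le_trans _ _ ((K + 1) * fine (nu A))).
  by apply: ler_wpM2r; [exact: (fine_ge0 (measure_ge0 nu _))|rewrite lerDl].
rewrite mulrC -ler_pdivlMr// ltW//.
by rewrite -lte_fin fineK// fin_num_measure.
Qed.

(* The Radon-Nikodym derivative h of A |-> T 1_A is bounded by K almost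
   everywhere; cutting it off where |h| >= K + 1 makes it bounded everywhere. *)
Lemma L1_functional_density : exists (g : E -> R) (M : R),
  [/\ measurable_fun setT g, forall x, `|g x| <= M &
      forall f, L1 f -> T f = \int[nu]_x (f x * g x)].
Proof.
pose eta : {charge set E -> \bar R} := ac_charge_of T_additive T_ac.
have eta_nu : eta `<< nu by exact: ac_charge_dominates.
pose h x := fine (Radon_Nikodym eta nu x).
have hE : EFin \o h = Radon_Nikodym eta nu.
  by apply/funext => x /=; rewrite fineK//; exact: Radon_Nikodym_fin_num.
have Ih : L1 h by rewrite hE; exact: Radon_Nikodym_integrable.
have mh : measurable_fun setT h by exact: L1_measurable Ih.
have etaE A : measurable A -> T \1_A = \int[nu]_(x in A) h x.
  move=> mA; have := Radon_Nikodym_integral eta_nu mA.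
  rewrite -hE /= /ac_charge => TA.
  by rewrite /Rintegral -TA.
pose G := [set x | `|h x| < K + 1].
have mG : measurable G.
  have -> : G = ~` [set x | K + 1 <= `|h x|].
    by apply/seteqP; split => x /=; rewrite /G/= ltNge => /negP.
  apply: measurableC.
  rewrite -[X in measurable X]setTI; apply: measurable_fun_le => //.
  exact: measurableT_comp.
have K10 : 0 < K + 1 by rewrite ltr_wpDl.
have IhM A : measurable A -> L1 (fun x => h x * \1_A x) by move=> mA; exact: L1_indicM.
(* The sign [s] treats both tails of [h] together. On such a set [B] one has
   [(K + 1) nu B <= s T 1_B <= K nu B], which forces [nu B = 0]. *)
have nu0 s : s = 1 \/ s = -1 -> nu [set x | K + 1 <= s * h x] = 0%E.
  move=> s1; set B := [set x | _].
  have mB : measurable B.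
    rewrite -[X in measurable X]setTI; apply: measurable_fun_le => //.
    exact: measurable_funM.
  have : (K + 1) * fine (nu B) <= K * fine (nu B).
    apply: le_trans (T_indic mB).
    apply: (@le_trans _ _ (s * T \1_B)); last first.
      by case: s1 => ->; rewrite ?mul1r ?mulN1r ?ler_norm// -normrN ler_norm.
    rewrite etaE// Rintegral_setE// -RintegralZl//; last exact: IhM.
    rewrite -Rintegral_indicZ//; apply: le_Rintegral => //.
    - by apply: L1Z; exact: L1_indic.
    - by apply: L1Z; exact: IhM.
    move=> x _; rewrite mulrA indicE; have [|] := boolP (x \in B).
      by rewrite inE !mulr1.
    by rewrite !mulr0.
  rewrite mulrDl mul1r gerDl => nuB.
  have : fine (nu B) == 0 by rewrite eq_le nuB fine_ge0.
  by rewrite fine_eq0 ?fin_num_measure// => /eqP.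
have nuGC : nu (~` G) = 0%E.
  apply/eqP; rewrite eq_le measure_ge0 andbT.
  pose B s := [set x | K + 1 <= s * h x].
  have mB s : measurable (B s).
    rewrite -[X in measurable X]setTI; apply: measurable_fun_le => //.
    exact: measurable_funM.
  apply: (@le_trans _ _ (nu (B 1 `|` B (-1)))).
    rewrite le_measure ?inE//; [exact: measurableC|exact: measurableU|].
    move=> x /negP; rewrite -leNgt /B/= mul1r mulN1r => Kh.
    have [h0|h0] := leP 0 (h x); first by left; rewrite ger0_norm in Kh.
    by right; rewrite ltr0_norm in Kh.
  apply: (@le_trans _ _ (nu (B 1%R) + nu (B (-1)%R))%E); first exact: measureU2.
  have -> : nu (B 1) = 0%E by apply: nu0; left.
  have -> : nu (B (-1)) = 0%E by apply: nu0; right.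
  by rewrite adde0.
pose g x := h x * \1_G x.
have mg : measurable_fun setT g by apply: measurable_funM => //; exact: measurable_indic.
have gM x : `|g x| <= K + 1.
  rewrite /g indicE; have [|_] := boolP (x \in G).
    by rewrite inE mulr1 => /ltW.
  by rewrite mulr0 normr0 ltW.
have Ig : L1 g by exact: IhM.
exists g, (K + 1); split => //.
apply: (@L1_simple_ind _ _ _ nu) => [A c mA|f1 f2 If1 If2 Tf1 Tf2|f If fP].
- have mAG : measurable (A `&` G) by exact: measurableI.
  rewrite TZ; last exact: L1_indic.
  under eq_Rintegral do rewrite -mulrA.
  rewrite RintegralZl//; last first.
    by apply: L1M_bounded mg gM; exact: L1_indic.
  congr (_ * _); have -> : \int[nu]_x (\1_A x * g x) =
      \int[nu]_(x in A `&` G) h x.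
    rewrite (Rintegral_setE _ _ mAG).
    apply: eq_Rintegral => x _; rewrite /g !indicE in_setI mulrCA.
    by case: (x \in A); case: (x \in G); rewrite /= ?(mul0r, mul1r).
  rewrite -(etaE _ mAG).
  rewrite -{1}(setUIDK A G) T_additive ?addr0//.
  + suff /eqP -> : T \1_(A `\` G) == 0 by rewrite addr0.
    rewrite -normr_le0; apply: (le_trans (T_indic _)); first exact: measurableD.
    suff -> : nu (A `\` G) = 0%E by rewrite mulr0.
    apply/eqP; rewrite eq_le measure_ge0 andbT -nuGC.
    apply: le_measure; rewrite ?inE; [exact: measurableD|exact: measurableC|].
    by move=> x [].
  + exact: measurableD.
  + by apply/seteqP; split => // x [[_ ?] []].
- rewrite TD// Tf1 Tf2 -RintegralD//; [|exact: L1M_bounded mg gM..].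
  by apply: eq_Rintegral => x _; rewrite mulrDl.
- apply/eqP; rewrite -subr_eq0 -normr_le0; apply/ler_addgt0Pr => e e0.
  (* [T] and integration against [g] are Lipschitz for the L1 norm with constants [K] and [K + 1];
     the sum fixes the tolerance of the approximation. *)
  have KK0 : 0 < K + (K + 1) by rewrite ltr_wpDl.
  have [f1 If1 [Tf1 ff1]] := fP (e / (K + (K + 1))) (divr_gt0 e0 KK0).
  have Id : L1 (fun x => f x - f1 x) by exact: L1B.
  have -> : T f - \int[nu]_x (f x * g x) =
      T (fun x => f x - f1 x) - \int[nu]_x ((f x - f1 x) * g x).
    under [in RHS]eq_Rintegral do rewrite mulrBl.
    rewrite TB// RintegralB//; [|exact: L1M_bounded mg gM..].
    by rewrite Tf1; ring.
  rewrite add0r (le_trans (ler_normB _ _))//.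
  apply: (@le_trans _ _ (K * \int[nu]_x `|f x - f1 x| +
                         (K + 1) * \int[nu]_x `|f x - f1 x|)).
    apply: lerD; first exact: TK.
    apply: (le_trans (le_normr_Rintegral _ _)) => //.
      exact: L1M_bounded mg gM.
    rewrite -RintegralZl//; last exact: L1_abs.
    apply: le_Rintegral => //.
    + by apply: L1_abs; exact: L1M_bounded mg gM.
    + by apply: L1Z; exact: L1_abs.
    by move=> x _; rewrite normrM mulrC ler_wpM2r.
  by rewrite -mulrDl mulrC -ler_pdivlMr// ltW.
Qed.

End functional.

(** For positive [e] the sum rounds [h] down to a multiple of [e], as [n] levels suffice to reach
    [h]. *)
Lemma layer_cake_step (h e : R) (n : nat) : 0 <= e -> 0 <= h -> h <= e *+ n ->
  `|h - \sum_(i < n) e * (e *+ i.+1 <= h)%R%:R| <= e.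
Proof.
move=> e0 h0; elim: n => [|n ih] hn.
  by rewrite big_ord0 subr0 (le_trans _ e0)// (@le_anti _ _ h 0) ?normr0// hn h0.
have [hn'|hn'] := leP h (e *+ n).
  have {ih} := ih hn'; rewrite big_ord_recr/=.
  have [en|en] := leP (e *+ n.+1) h; last by rewrite mulr0 addr0.
  have -> : e = 0.
    apply/eqP; rewrite eq_le e0 andbT; have := le_trans en hn'.
    by rewrite mulrS gerDr.
  by rewrite mul0r addr0.
rewrite big_ord_recr/=.
have -> : \sum_(i < n) e * (e *+ i.+1 <= h)%R%:R = e *+ n.
  rewrite (eq_bigr (fun=> e)) ?sumr_const ?card_ord// => i _.
  by rewrite (le_trans _ (ltW hn')) ?mulr1// ler_wpMn2l.
have [en|en] := leP (e *+ n.+1) h; rewrite ?mulr1 ?mulr0 ler_norml.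
  have -> : h = e *+ n.+1 by apply/le_anti; rewrite hn en.
  by rewrite -mulrSr subrr oppr_le0 e0.
move: hn en hn'; rewrite mulrS; move: (e *+ n) => a ? ? ?.
by apply/andP; split; lra.
Qed.

(** A bounded [g] is uniformly within [a] of a finite combination of indicators. Setwise convergence
    handles the combination, and the L1 bound [K] handles the remainder. *)
Lemma cvg_Rintegral_bounded (h : nat -> E -> R) (g : E -> R) (K M : R) :
  (forall n, L1 (h n)) -> (forall n, \int[nu]_x `|h n x| <= K) ->
  (forall A, measurable A -> \int[nu]_(x in A) h n x @[n --> \oo] --> 0) ->
  measurable_fun setT g -> (forall x, `|g x| <= M) ->
  \int[nu]_x (h n x * g x) @[n --> \oo] --> 0.
Proof.
move=> Ih hK hA mg gM; apply/cvgrPdist_lt => e e0.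
have K0 : 0 <= K by apply: le_trans (hK 0%N); apply: Rintegral_ge0.
pose a := e / 2 / (K + 1).
have a0 : 0 < a by rewrite !divr_gt0// ltr_wpDl.
have M0 : 0 <= M by exact: le_trans (gM point).
have [N MN] : exists N : nat, M + M <= a *+ N.
  exists (Num.truncn ((M + M) / a)).+1; rewrite -mulr_natr -ler_pdivrMl// mulrC.
  by rewrite ltW// truncnS_gt.
(* Adding [M] makes the function nonnegative with values in [[0, 2 M]], so [N] levels of height [a]
   are enough; the shift is subtracted again in [s]. *)
pose A i := [set x | a *+ i.+1 <= g x + M].
have mA i : measurable (A i).
  rewrite -[X in measurable X]setTI; apply: measurable_fun_le => //.
  exact: measurable_funD.
pose s x := \sum_(i < N) a * \1_(A i) x - M.
have gs x : `|g x - s x| <= a.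
  rewrite /s opprB addrA; under eq_bigr do rewrite indicE mem_setE.
  have := gM x; rewrite ler_norml => /andP[? ?].
  apply: layer_cake_step; [exact: ltW|lra|].
  by apply: le_trans MN; lra.
have ms : measurable_fun setT s.
  apply: measurable_funB => //; apply: measurable_sum => i.
  by apply: measurable_funM => //; exact: measurable_indic.
have Ihs n : L1 (fun x => h n x * s x).
  apply: (@L1M_bounded _ _ (M + a)) => // x.
  have -> : s x = g x - (g x - s x) by rewrite subKr.
  by rewrite (le_trans (ler_normB _ _))// lerD.
have Ihg n : L1 (fun x => h n x * g x) by exact: L1M_bounded mg gM.
have IhA n i : L1 (fun x => a * (h n x * \1_(A i) x)).
  by apply: L1Z; exact: L1_indicM.
have hsE n : \int[nu]_x (h n x * s x) =
    \sum_(i < N) a * \int[nu]_(x in A i) h n x - M * \int[nu]_(x in setT) h n x.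
  have -> : \int[nu]_x (h n x * s x) = \int[nu]_x
      (\sum_(i < N) a * (h n x * \1_(A i) x) - M * h n x).
    apply: eq_Rintegral => x _; rewrite /s mulrBr mulr_sumr [M * _]mulrC.
    by congr (_ - _); apply: eq_bigr => i _; rewrite mulrCA.
  rewrite RintegralB//; [|exact: L1_sum|exact: L1Z].
  rewrite RintegralZl//; congr (_ - _).
  rewrite Rintegral_sum//; apply: eq_bigr => i _.
  by rewrite RintegralZl ?(Rintegral_setE _ _ (mA i))//; exact: L1_indicM.
have hs : \int[nu]_x (h n x * s x) @[n --> \oo] --> 0.
  under eq_fun do rewrite hsE.
  have sum0 k : \sum_(i < k) a * \int[nu]_(x in A i) h n x @[n --> \oo] --> 0.
    elim: k => [|k ih].
      by under eq_fun do rewrite big_ord0; exact: cvg_cst.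
    under eq_fun do rewrite big_ord_recr/=.
    have := cvgD ih (cvgM (cvg_cst a) (hA _ (mA k))).
    rewrite mulr0 addr0; exact.
  have := cvgB (sum0 N) (cvgM (cvg_cst M) (hA _ measurableT)).
  rewrite mulr0 subr0; exact.
move/cvgrPdist_lt : hs => /(_ (e / 2)) [|n0 _ n0P]; first by rewrite divr_gt0.
exists n0 => // n nn0; have := n0P n nn0; rewrite /= !sub0r !normrN => hs.
have -> : \int[nu]_x (h n x * g x) =
    \int[nu]_x (h n x * s x) + \int[nu]_x (h n x * g x - h n x * s x).
  by rewrite RintegralB// addrC subrK.
rewrite (le_lt_trans (ler_normD _ _))// [e in ltRHS]splitr ltr_leD//.
apply: (le_trans (le_normr_Rintegral _ _)) => //; first exact: L1B.
apply: (@le_trans _ _ (a * \int[nu]_x `|h n x|)).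
  rewrite -RintegralZl//; last exact: L1_abs.
  apply: le_Rintegral => //.
  - by apply: L1_abs; exact: L1B.
  - by apply: L1Z; exact: L1_abs.
  by move=> x _; rewrite -mulrBr normrM mulrC ler_wpM2r.
apply: (@le_trans _ _ (a * (K + 1))).
  by rewrite ler_wpM2l// ?ltW// (le_lt_trans (hK n))// ltrDl.
by rewrite /a divfK// gt_eqF// ltr_wpDl.
Qed.

End L1_dual.

Lemma cvg_combination (R : realType) (a b : nat -> R[i]^o) (c l : R[i]^o) :
  a n @[n --> \oo] --> (0 : R[i]^o) -> b n @[n --> \oo] --> (0 : R[i]^o) ->
  (a n + c *: b n + l) @[n --> \oo] --> l.
Proof.
move=> a0 b0.
have cb : (c *: b n) @[n --> \oo] --> c *: (0 : R[i]^o).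
  by apply: cvgZr; exact: b0.
have acb : (a n + c *: b n) @[n --> \oo] --> (0 : R[i]^o) + c *: (0 : R[i]^o).
  by apply: cvgD; [exact: a0|exact: cb].
rewrite scaler0 addr0 in acb.
have : (a n + c *: b n + l) @[n --> \oo] --> (0 : R[i]^o) + l.
  by apply: cvgD; [exact: acb|exact: cvg_cst].
by rewrite add0r.
Qed.

(** * Complex measures with a density *)

Section density_measure.
Context d (E : measurableType d) (R : realType) (nu : probability E R).
Local Notation M := (complex_measure E R).
Local Notation L1 f := (nu.-integrable [set: E] (EFin \o f)).
Implicit Types f g : E -> R.

(** Made total by the value 0, so that composing with a functional on measures gives a functional on
    all real functions. *)
Definition density_measure f : M :=
  match pselect (L1 f) with
  | left If => complex_of_charges (induced_charge If) (@czero _ E R)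
  | right _ => 0
  end.

Lemma density_measureE f A : L1 f -> measurable A ->
  density_measure f A = (\int[nu]_(y in A) f y)%:C.
Proof.
move=> If mA; rewrite /density_measure; case: pselect => // If'.
by rewrite complex_of_chargesE.
Qed.

Lemma density_measureD f g : L1 f -> L1 g ->
  density_measure (fun x => f x + g x) = density_measure f + density_measure g.
Proof.
move=> If Ig; apply: complex_measure_eq => A mA.
rewrite -[RHS]/(density_measure f A + density_measure g A).
rewrite !density_measureE//; last exact: L1D.
rewrite RintegralD ?rmorphD//; exact: integrableS (_ : nu.-integrable setT _).
Qed.

Lemma density_measureZ c f : L1 f ->
  density_measure (fun x => c * f x) = c%:C *: density_measure f.
Proof.
move=> If; apply: complex_measure_eq => A mA.
rewrite -[RHS]/(c%:C * density_measure f A).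
rewrite !density_measureE//; last exact: L1Z.
rewrite RintegralZl ?rmorphM//; exact: integrableS (_ : nu.-integrable setT _).
Qed.

(** The blocks are disjoint, so their indicators sum to at most 1 at every point. *)
Lemma norm_density_measure f : L1 f ->
  fine (Defs.total_variation (density_measure f)) <= \int[nu]_x `|f x|.
Proof.
move=> If; rewrite -lee_fin fineK ?total_variation_fin_num//.
apply: ge_ereal_sup => _ [n [P [mP tP _ ->]]]; rewrite lee_fin.
have IP i : L1 (fun x => `|f x| * \1_(P i) x) by apply: L1_indicM => //; exact: L1_abs.
apply: (@le_trans _ _ (\sum_(i < n) \int[nu]_x (`|f x| * \1_(P i) x))).
  apply: ler_sum => i _; rewrite density_measureE//.
  rewrite /= expr0n/= addr0 sqrtr_sqr (Rintegral_setE _ _ (mP i)).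
  apply: (le_trans (le_normr_Rintegral _ _)) => //; first exact: L1_indicM.
  apply: le_Rintegral => //; first by apply: L1_abs; exact: L1_indicM.
  by move=> x _; rewrite normrM [`|\1_ _ _|]ger0_norm.
rewrite -Rintegral_sum//; apply: le_Rintegral => //.
- exact: L1_sum.
- exact: L1_abs.
move=> x _; rewrite -mulr_sumr ler_piMr//.
have [[i Pix]|nP] := pselect (exists i, P i x); last first.
  by rewrite big1// => i _; rewrite indicE memNset// => Pix; apply: nP; exists i.
rewrite (bigD1 i)//= indicE mem_set// big1 ?addr0// => j ji.
rewrite indicE memNset// => Pjx; move/eqP : ji; apply.
by apply: tP => //; exists x.
Qed.

Lemma complex_measure_density (mu : M) :
  (forall A, measurable A -> nu A = 0%E -> mu A = 0) ->
  exists f g, [/\ L1 f, L1 g &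
    mu = density_measure f + (0 +i* 1) *: density_measure g].
Proof.
move=> munu.
have RN (c : {charge set E -> \bar R}) : (forall A, measurable A ->
    nu A = 0%E -> c A = 0%E) -> exists2 f, L1 f &
    forall A, measurable A -> fine (c A) = \int[nu]_(x in A) f x.
  move=> cnu; have c_nu : c `<< nu by apply/null_content_dominatesP.
  exists (fine \o Radon_Nikodym c nu).
    rewrite (_ : EFin \o _ = Radon_Nikodym c nu).
      exact: Radon_Nikodym_integrable.
    by apply/funext => x /=; rewrite fineK//; exact: Radon_Nikodym_fin_num.
  move=> A mA; rewrite (Radon_Nikodym_integral c_nu mA); congr fine.
  by apply: eq_integral => x _ /=; rewrite fineK//; exact: Radon_Nikodym_fin_num.
have [f If fE] : exists2 f, L1 f & forall A, measurable A ->
    complex.Re (mu A) = \int[nu]_(x in A) f x.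
  by apply: (RN (re_part mu)) => A mA nuA; rewrite /= /re_part munu.
have [g Ig gE] : exists2 f, L1 f & forall A, measurable A ->
    complex.Im (mu A) = \int[nu]_(x in A) f x.
  by apply: (RN (im_part mu)) => A mA nuA; rewrite /= /im_part munu.
exists f, g; split => //; apply: complex_measure_eq => A mA.
rewrite -[RHS]/(density_measure f A + (0 +i* 1) * density_measure g A).
rewrite !density_measureE// -fE// -gE//.
by case: (mu A) => a b; simpc.
Qed.

Lemma continuous_functional_bounded (phi : {linear M -> R[i]^o}) :
  continuous phi -> exists K : R, forall mu : M,
    normc (phi mu) <= K * fine (Defs.total_variation mu).
Proof.
move=> /linear_bounded_continuous/linear_boundedP/pinfty_ex_gt0[k k0 phik].
exists (complex.Re k) => mu; rewrite -lecR rmorphM/=.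
(* In the order of [R[i]] a positive number is real. *)
have -> : (complex.Re k)%:C = k.
  by move: k0; case: (k) => a b; rewrite ltcE/= => /andP[/eqP -> _].
exact: phik.
Qed.

(** On densities, the real and imaginary parts of [phi] are bounded real functionals on L1, hence
    integrals against bounded functions. *)
Lemma cvg_functional_density (phi : {linear M -> R[i]^o}) (h : nat -> E -> R)
    (K : R) : continuous phi ->
  (forall n, L1 (h n)) -> (forall n, \int[nu]_x `|h n x| <= K) ->
  (forall A, measurable A -> \int[nu]_(x in A) h n x @[n --> \oo] --> 0) ->
  phi (density_measure (h n)) @[n --> \oo] --> (0 : R[i]^o).
Proof.
move=> /continuous_functional_bounded[k phik] Ih hK hA.
have k0 : 0 <= Num.max 0 k by rewrite le_max lexx.
have phi_le f : L1 f ->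
    normc (phi (density_measure f)) <= Num.max 0 k * \int[nu]_x `|f x|.
  move=> If; apply: (le_trans (phik _)).
  apply: (@le_trans _ _ (Num.max 0 k * fine (Defs.total_variation (density_measure f)))).
    by rewrite ler_wpM2r ?fine_ge0 ?Defs.total_variation_ge0// le_max lexx orbT.
  by rewrite ler_wpM2l// norm_density_measure.
have cvg_part (T : (E -> R) -> R) :
    (forall f g, L1 f -> L1 g -> T (fun x => f x + g x) = T f + T g) ->
    (forall c f, L1 f -> T (fun x => c * f x) = c * T f) ->
    (forall f, L1 f -> `|T f| <= Num.max 0 k * \int[nu]_x `|f x|) ->
    T (h n) @[n --> \oo] --> 0.
  move=> TD TZ TK; have [g [m [mg gm gE]]] := L1_functional_density TD TZ TK.
  under eq_fun do rewrite gE//.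
  exact: (cvg_Rintegral_bounded Ih hK hA mg gm).
apply/cvg_complexP; split.
- apply: (cvg_part (fun f => complex.Re (phi (density_measure f)))).
  + by move=> f g If Ig; rewrite density_measureD// linearD ReD.
  + move=> c f If; rewrite density_measureZ// linearZ/=.
    by case: (phi _) => a b; simpc.
  + by move=> f If; apply: le_trans (phi_le f If); exact: normRe_le.
- apply: (cvg_part (fun f => complex.Im (phi (density_measure f)))).
  + by move=> f g If Ig; rewrite density_measureD// linearD ImD.
  + move=> c f If; rewrite density_measureZ// linearZ/=.
    by case: (phi _) => a b; simpc.
  + by move=> f If; apply: le_trans (phi_le f If); exact: normIm_le.
Qed.

(** The differences [v n - l] have densities for their real and imaginary parts. The setwise bound
    [K] bounds the L1 norms of these by [2 K], which reduces the claim to densities. *)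
Lemma cvg_functional_setwise (phi : {linear M -> R[i]^o}) (v : nat -> M) (l : M)
    (K : R) : continuous phi ->
  (forall n A, measurable A -> nu A = 0%E -> v n A = 0) ->
  (forall A, measurable A -> nu A = 0%E -> l A = 0) ->
  (forall n A, measurable A -> normc (v n A - l A) <= K) ->
  (forall A, measurable A -> (v n A : R[i]^o) @[n --> \oo] --> (l A : R[i]^o)) ->
  phi (v n) @[n --> \oo] --> phi l.
Proof.
move=> phic vnu lnu vlK vl.
have /choice[fg fgP] n : exists fg : (E -> R) * (E -> R),
    [/\ L1 fg.1, L1 fg.2 &
    v n - l = density_measure fg.1 + (0 +i* 1) *: density_measure fg.2].
  have [A mA nuA|f [g [If Ig ->]]] := @complex_measure_density (v n - l).
    rewrite -[LHS]/(v n A - l A) vnu// lnu// subrr//.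
  by exists (f, g).
have vE n A : measurable A -> v n A - l A =
    (\int[nu]_(x in A) (fg n).1 x) +i* (\int[nu]_(x in A) (fg n).2 x).
  move=> mA; have [If Ig vlE] := fgP n.
  rewrite -[LHS]/((v n - l) A) vlE.
  rewrite -[LHS]/(density_measure (fg n).1 A + (0 +i* 1) * density_measure (fg n).2 A).
  by rewrite !density_measureE//; simpc.
have vl0 A : measurable A -> (v n A - l A : R[i]^o) @[n --> \oo] --> (0 : R[i]^o).
  by move=> mA; apply/subr_cvg0; exact: vl.
have cvg1 : phi (density_measure (fg n).1) @[n --> \oo] --> (0 : R[i]^o).
  apply: (@cvg_functional_density phi (fun n => (fg n).1) (K *+ 2)) => //.
  - by move=> n; have [] := fgP n.
  - move=> n; apply: Rintegral_abs_le; first by have [] := fgP n.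
    move=> B mB; apply: le_trans (vlK n B mB).
    by rewrite vE//; exact: (normRe_le (_ +i* _)).
  - move=> A mA; have /cvg_complexP[+ _] := vl0 A mA.
    by under eq_fun do rewrite vE//.
have cvg2 : phi (density_measure (fg n).2) @[n --> \oo] --> (0 : R[i]^o).
  apply: (@cvg_functional_density phi (fun n => (fg n).2) (K *+ 2)) => //.
  - by move=> n; have [] := fgP n.
  - move=> n; apply: Rintegral_abs_le; first by have [] := fgP n.
    move=> B mB; apply: le_trans (vlK n B mB).
    by rewrite vE//; exact: (normIm_le (_ +i* _)).
  - move=> A mA; have /cvg_complexP[_ +] := vl0 A mA.
    by under eq_fun do rewrite vE//.
have phiE n : phi (v n) = phi (density_measure (fg n).1) +
    (0 +i* 1) *: phi (density_measure (fg n).2) + phi l.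
  have [_ _ vlE] := fgP n.
  by rewrite -[v n](subrK l) linearD vlE linearD linearZ.
under eq_fun do rewrite phiE.
exact: cvg_combination cvg1 cvg2.
Qed.

End density_measure.

(** * From a uniformly integrable density to weak compactness *)

Section Kstar_weakly_compact.
Context d (E : measurableType d) (R : realType) (Q : R.-fker E ~> E).
Local Notation M := (complex_measure E R).

(** [A] is cut at a level [m] of [alpha (x, _)]. Uniform integrability bounds the part above by
    [e / 2], and [m * nu A] bounds the part below. *)
Lemma density_kernel_uniform_ac (nu : probability E R) (alpha : E * E -> R) :
  uniformly_integrable_densities nu alpha ->
  forall e : R, 0 < e -> exists2 t : R, 0 < t &
    forall A, measurable A -> (nu A < t%:E)%E ->
    forall x, (density_kernel nu alpha x A <= e%:E)%E.
Proof.
move=> [alpha0 malpha UI] e e0.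
have e20 : 0 < e / 2 by rewrite divr_gt0.
have malpha_x x : measurable_fun setT (fun y => alpha (x, y)).
  exact: measurable_fun_pair2 malpha.
have mP m x : measurable [set y | m <= alpha (x, y)].
  by rewrite -[X in measurable X]setTI; apply: measurable_fun_le.
have [m [m0 mUI]] : exists m : R, 0 < m /\ forall x,
    (\int[nu]_(y in [set y | (m <= alpha (x, y))%R]) (alpha (x, y))%:E
       <= (e / 2)%:E)%E.
  (* Convergence to 0 includes that the supremum is eventually finite, without which a bound on its
     [fine] would say nothing. *)
  move/fine_cvgP : UI => [UIfin /cvgr_lt/(_ _ e20) UIlt].
  near +oo_R => m; exists m; split.
    by near: m; apply: nbhs_pinfty_gt; exact: num_real.
  move=> x; apply: (@le_trans _ _ (ereal_sup (range (fun x => (\int[nu]_(y in [set y |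
      (m <= alpha (x, y))%R]) (alpha (x, y))%:E)%E)))).
    by apply: ereal_sup_ubound; exists x.
  have mfin : ereal_sup (range (fun x => (\int[nu]_(y in [set y |
      (m <= alpha (x, y))%R]) (alpha (x, y))%:E)%E)) \is a fin_num by near: m.
  rewrite -(fineK mfin) lee_fin ltW//.
  by near: m.
exists (e / 2 / m); first by rewrite divr_gt0.
move=> A mA nuA x; rewrite /density_kernel.
pose P := [set y | m <= alpha (x, y)].
have mAP : measurable (A `&` P) by apply: measurableI => //; exact: mP.
have mAnP : measurable (A `\` P) by apply: measurableD => //; exact: mP.
rewrite -(setUIDK A P) ge0_integral_setU//; last 3 first.
- by apply/measurable_EFinP; exact: measurable_funTS.
- by move=> y _; rewrite lee_fin.
- by rewrite disj_set2E; apply/eqP/seteqP; split => // y [[_ ?] []].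
rewrite [e in leRHS]splitr EFinD; apply: leeD.
  apply: le_trans (mUI x); apply: ge0_subset_integral => //.
    by apply/measurable_EFinP; exact: measurable_funTS.
  by move=> y _; rewrite lee_fin.
apply: (@le_trans _ _ (\int[nu]_(y in A `\` P) (cst m%:E y))%E).
  apply: ge0_le_integral => //.
  - by move=> y _; rewrite lee_fin.
  - by apply/measurable_EFinP; exact: measurable_funTS.
  by move=> y [_] /negP; rewrite -ltNge lee_fin => /ltW.
rewrite integral_cst//.
apply: (@le_trans _ _ (m%:E * (e / 2 / m)%:E)%E).
  rewrite lee_pmul2l//; apply: le_trans (ltW nuA).
  by rewrite le_measure ?inE//; move=> y [].
by rewrite -EFinM lee_fin mulrC divfK// gt_eqF.
Unshelve. all: by end_near. Qed.

(** Each Jordan part has as total mass the absolute value of [c] on one of the Hahn sets, at most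
    [k]; the two parts give the factor 2. *)
Lemma charge_integral_bound (c : {charge set E -> \bar R}) (f : E -> R) (k b : R) :
  (forall A, measurable A -> `|fine (c A)| <= k) -> measurable_fun setT f ->
  (forall x, 0 <= f x <= b) -> `|charge_integral c f| <= b * k *+ 2.
Proof.
move=> ck mf fb; have b0 : 0 <= b.
  by have /andP[f0 fb0] := fb point; exact: le_trans fb0.
have fle (m : {finite_measure set E -> \bar R}) : fine (m setT) <= k ->
    `|\int[m]_x f x| <= b * k.
  move=> mk; have If : m.-integrable setT (EFin \o f).
    apply: (@L1_bounded _ _ _ _ _ b) => // x.
    by have /andP[f0 fb0] := fb x; rewrite ger0_norm.
  have -> : `|\int[m]_x f x| = \int[m]_x f x.
    by rewrite ger0_norm//; apply: Rintegral_ge0 => x _; have /andP[] := fb x.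
  apply: (@le_trans _ _ (\int[m]_x (cst b x))).
    apply: le_Rintegral => //; first exact: finite_measure_integrable_cst.
    by move=> x _; have /andP[] := fb x.
  by rewrite Rintegral_cst// ler_wpM2l.
have [[mP _] [mN _] _ _] := hahnP c.
have posE : jordan_pos (hahnP c) setT = c (setT `&` hahn_pos c).
  by rewrite jordan_posE cjordan_posE /crestr0 mem_set.
have negE : jordan_neg (hahnP c) setT = (- c (setT `&` hahn_neg c))%E.
  by rewrite jordan_negE cjordan_negE /crestr0 mem_set.
rewrite /charge_integral mulr2n (le_trans (ler_normB _ _))// lerD//.
  apply: fle; apply: (@le_trans _ _ (fine (c (setT `&` hahn_pos c)))).
    rewrite le_eqVlt; apply/orP; left; apply/eqP; exact: (congr1 fine posE).
  by rewrite (le_trans (ler_norm _))// ck//; exact: measurableI.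
apply: fle; apply: (@le_trans _ _ (- fine (c (setT `&` hahn_neg c)))).
  rewrite -fineN le_eqVlt; apply/orP; left; apply/eqP; exact: (congr1 fine negE).
by rewrite (le_trans (ler_norm _))// normrN ck//; exact: measurableI.
Qed.

(** This carries bounds on [Q x A] that are uniform in [x] over to the whole image of the unit
    ball. *)
Lemma kernel_adjoint_bound (mu : M) (A : set E) (b : R) : `|mu| <= 1 ->
  measurable A -> (forall x, (Q x A <= b%:E)%E) ->
  `|complex.Re (kernel_adjoint Q mu A)| <= b *+ 2 /\
  `|complex.Im (kernel_adjoint Q mu A)| <= b *+ 2.
Proof.
move=> mu1 mA Qb.
have muB B : measurable B -> normc (mu B) <= 1.
  move=> mB; rewrite -lecR -normc_E.
  exact: le_trans (norm_eval_measure mu B) mu1.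
have mQ : measurable_fun setT (fun x => fine (Q x A)).
  by apply: measurableT_comp => //; exact: measurable_kernel.
have Q0b x : 0 <= fine (Q x A) <= b.
  rewrite fine_ge0//= -lee_fin fineK//; exact: kernel_finite_transition.
rewrite -[b]mulr1 /= /kernel_adjoint_fun mem_set//=; split.
- apply: charge_integral_bound => // B mB.
  by rewrite /= (le_trans (normRe_le _))// muB.
- apply: charge_integral_bound => // B mB.
  by rewrite /= (le_trans (normIm_le _))// muB.
Qed.

Lemma Kstar_weakly_compact : countably_generated E -> Kstar Q ->
  weakly_sequentially_compact (kernel_adjoint Q @` [set mu : M | `|mu| <= 1]).
Proof.
move=> hE [nu [alpha [UI QE]]] u uU.
have [r r0 Qr] := kernel_bounded Q.
have uac e : 0 < e -> exists2 t : R, 0 < t & forall A, measurable A ->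
    (nu A < t%:E)%E -> forall n, `|complex.Re (u n A)| <= e /\
                                 `|complex.Im (u n A)| <= e.
  move=> e0; have e20 : 0 < e / 2 by rewrite divr_gt0.
  have [t t0 tP] := density_kernel_uniform_ac UI e20.
  exists t => // A mA nuA n; have [mu mu1 <-] := uU n.
  have -> : e = (e / 2) *+ 2 by rewrite -mulr_natr divfK// pnatr_eq0.
  by apply: kernel_adjoint_bound => // x; rewrite QE//; exact: tP.
have ur n A : measurable A ->
    `|complex.Re (u n A)| <= r *+ 2 /\ `|complex.Im (u n A)| <= r *+ 2.
  move=> mA; have [mu mu1 <-] := uU n.
  by apply: kernel_adjoint_bound => // x; exact: Qr.
have [C [mC denseC]] := countable_dense_sets R hE.
have [s sinc scvg] : exists2 s : nat -> nat, increasing_seq s & forall j,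
    cvgn (fun k => complex.Re (u (s k) (C j))) /\
    cvgn (fun k => complex.Im (u (s k) (C j))).
  (* Real and imaginary parts are interleaved, so that one diagonal extraction serves both. *)
  pose w j n := if odd j then complex.Im (u n (C j./2))
                else complex.Re (u n (C j./2)).
  have [|s sinc sw] := @diagonal_cvg R w.
    move=> j; exists (r *+ 2) => n; have [rRe rIm] := ur n _ (mC j./2).
    by rewrite /w; case: (odd j).
  exists s => // j; split.
    have := sw j.*2; rewrite /comp /w odd_double doubleK; exact.
  by have := sw j.*2.+1; rewrite /comp /w /= odd_double/= uphalf_double; exact.
have cvgRe B : measurable B -> cvgn (fun k => complex.Re (u (s k) B)).
  apply: (@setwise_cvg_dense _ _ _ nu (fun k => re_part (u (s k))) _ C) => //.
  - move=> e e0; have [t t0 tP] := uac e e0; exists t => // A mA nuA n.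
    by have [] := tP A mA nuA (s n).
  - by move=> ? ?; exact: denseC.
  - by move=> j; have [] := scvg j.
have cvgIm B : measurable B -> cvgn (fun k => complex.Im (u (s k) B)).
  apply: (@setwise_cvg_dense _ _ _ nu (fun k => im_part (u (s k))) _ C) => //.
  - move=> e e0; have [t t0 tP] := uac e e0; exists t => // A mA nuA n.
    by have [] := tP A mA nuA (s n).
  - by move=> ? ?; exact: denseC.
  - by move=> j; have [] := scvg j.
pose LRe B := limn (fun k => complex.Re (u (s k) B)).
pose LIm B := limn (fun k => complex.Im (u (s k) B)).
have LReU A B : measurable A -> measurable B -> A `&` B = set0 ->
    LRe (A `|` B) = LRe A + LRe B.
  move=> mA mB AB; rewrite /LRe -limD; [|exact: cvgRe|exact: cvgRe].
  congr (limn _); apply/funext => k /=.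
  exact: (@fine_chargeU _ _ _ (re_part (u (s k)))).
have LImU A B : measurable A -> measurable B -> A `&` B = set0 ->
    LIm (A `|` B) = LIm A + LIm B.
  move=> mA mB AB; rewrite /LIm -limD; [|exact: cvgIm|exact: cvgIm].
  congr (limn _); apply/funext => k /=.
  exact: (@fine_chargeU _ _ _ (im_part (u (s k)))).
have lim_abs_le (a : nat -> R) b : cvgn a -> (forall k, `|a k| <= b) ->
    `|limn a| <= b.
  move=> ca ab; rewrite -lim_norm//; apply: limr_le; first exact: is_cvg_norm.
  exact: nearW.
have LReac e : 0 < e -> exists2 t : R, 0 < t & forall A, measurable A ->
    (nu A < t%:E)%E -> `|LRe A| <= e.
  move=> e0; have [t t0 tP] := uac e e0; exists t => // A mA nuA.
  apply: lim_abs_le; first exact: cvgRe.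
  by move=> k; have [] := tP A mA nuA (s k).
have LImac e : 0 < e -> exists2 t : R, 0 < t & forall A, measurable A ->
    (nu A < t%:E)%E -> `|LIm A| <= e.
  move=> e0; have [t t0 tP] := uac e e0; exists t => // A mA nuA.
  apply: lim_abs_le; first exact: cvgIm.
  by move=> k; have [] := tP A mA nuA (s k).
(* The setwise limits inherit finite additivity and uniform absolute continuity, which together make
   them charges. *)
pose l : M := complex_of_charges (ac_charge_of LReU LReac) (ac_charge_of LImU LImac).
have lE A : measurable A -> l A = LRe A +i* LIm A.
  by move=> mA; rewrite /l complex_of_chargesE.
have ac0 (x : R) : (forall e, 0 < e -> `|x| <= e) -> x = 0.
  move=> xe; apply/eqP; rewrite -normr_le0; apply/ler_addgt0Pr => e e0.
  by rewrite add0r xe.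
exists l, s; split => // phi phic.
(* The real and the imaginary part of a difference are each at most [2 r + 2 r]. *)
apply: (@cvg_functional_setwise _ _ _ nu phi (u \o s) l (r *+ 8)) => //.
- move=> n A mA nuA /=; rewrite [LHS]complexE.
  have -> : complex.Re (u (s n) A) = 0.
    apply: ac0 => e e0; have [t t0 tP] := uac e e0.
    have nuAt : (nu A < t%:E)%E by rewrite nuA lte_fin.
    by have [] := tP A mA nuAt (s n).
  have -> : complex.Im (u (s n) A) = 0.
    apply: ac0 => e e0; have [t t0 tP] := uac e e0.
    have nuAt : (nu A < t%:E)%E by rewrite nuA lte_fin.
    by have [] := tP A mA nuAt (s n).
  by rewrite mulr0 addr0.
- move=> A mA nuA; rewrite lE//.
  have -> : LRe A = 0.
    apply: ac0 => e e0; have [t t0 tP] := LReac e e0.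
    by apply: tP => //; rewrite nuA lte_fin.
  have -> // : LIm A = 0.
  apply: ac0 => e e0; have [t t0 tP] := LImac e e0.
  by apply: tP => //; rewrite nuA lte_fin.
- move=> n A mA; have [uRe uIm] := ur (s n) _ mA.
  have lRe : `|LRe A| <= r *+ 2.
    by apply: lim_abs_le; [exact: cvgRe|move=> k; have [] := ur (s k) _ mA].
  have lIm : `|LIm A| <= r *+ 2.
    by apply: lim_abs_le; [exact: cvgIm|move=> k; have [] := ur (s k) _ mA].
  rewrite lE//; apply: (le_trans (normc_le _)).
  rewrite ReD ImD ReN ImN.
  rewrite (_ : r *+ 8 = (r *+ 2 + r *+ 2) + (r *+ 2 + r *+ 2)); last by rewrite -!mulrnDr.
  by apply: lerD; rewrite (le_trans (ler_normB _ _))// lerD.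
- move=> A mA; rewrite lE//; apply/cvg_complexP; split => /=.
  + exact: cvgRe.
  + exact: cvgIm.
Qed.

End Kstar_weakly_compact.

Theorem mainTheorem7 (d : measure_display) (E : measurableType d) (R : realType)
    (hE : countably_generated E) (Q : R.-fker E ~> E) :
  Kstar Q <->
  weakly_sequentially_compact
    (kernel_adjoint Q @` [set mu : complex_measure E R | `|mu| <= 1]).
Proof.
by split; [exact: Kstar_weakly_compact|exact: weakly_compact_Kstar].
Qed.
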